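(* Let $d\ge3$ and $h\in\mathbb R$, and suppose that for each integer $L\ge1$ we are given an $h$-admissible family of events $(\mathcal E^b_B,\mathcal E^{vb}_B)_{B\in L\mathbb Z^d}$. For every $\rho>0$ and $\delta>0$ there exist constants $t=t(d,\rho,\delta)\in(0,1)$, $L_0=L_0(d,\rho,\delta)>0$ and $N_0=N_0(d,\rho,\delta)>0$ (not depending on $h$ or on the chosen events) such that for every $N\ge N_0$ there is a family $\mathcal I_N$ of interfaces with the following properties: (a) $|\mathcal I_N|\le e^{\delta tN}$; (b) every $\mathcal I\in\mathcal I_N$ satisfies $L_0\le L_1$ and $|\mathcal I|\le\delta tN$, where $L_1$ is the smallest scale of $\mathcal I$; (c) on the event $A_N(h)$, some $\mathcal I\in\mathcal I_N$ occurs such that its largest scale $L_k$ satisfies $L_k\le\mathrm{diam}(\mathcal C_o(h))$, $\mathcal B(\mathcal I)\subset L_1\mathbb Z^d$, and at least one of the following holds: (c1) $\mathrm{cap}\big(\bigcup_{B\in\mathcal{VB}(\mathcal I)}B\big)\ge N/(4d)$; (c2) $|\mathcal B(\mathcal I)|\,L_1^{\rho}\ge tN$.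
   Context: $\varphi$ is the GFF on $\mathbb Z^d$ (centered Gaussian, covariance the Green function $g(x,y)=\frac1{2d}\sum_{n\ge0}P_x[X_n=y]$ of simple random walk). $\mathcal C_o(h)$ is the cluster of the origin in the induced subgraph $\{\varphi\ge h\}$; diameters are with respect to the graph distance of $\mathbb Z^d$. $\overline S=S\cup\{x\notin S:x\sim y\in S\}$, $\mathrm{cap}(K)=\sum_{x\in K}2dP_x[\widetilde H_K=\infty]$, $\widetilde H_K=\min\{n\ge1:X_n\in K\}$, and $A_N(h)=\{|\mathcal C_o(h)|<\infty\}\cap\{N-1\le\mathrm{cap}(\overline{\mathcal C_o(h)})<N\}$. For an integer $L\ge1$, $L\mathbb Z^d$ is identified with the set of boxes $B_L(z)=z+[0,L)^d$, $z\in L\mathbb Z^d$, with the graph structure where $B_L(z),B_L(w)$ are neighbours iff $\|z-w\|_1=L$. $\mathcal C_o(h,L)$ is the set of boxes of $L\mathbb Z^d$ containing a vertex of $\mathcal C_o(h)$; for a set $\mathcal S$ of boxes, $\partial\mathcal S$ is the set of boxes of $\mathcal S$ having a neighbour in $L\mathbb Z^d\setminus\mathcal S$. A family of events $\mathcal E^b_B,\mathcal E^{vb}_B$, $B\in L\mathbb Z^d$, is $h$-admissible if, with $\mathcal E_B=\mathcal E^b_B\cup\mathcal E^{vb}_B$: (i) $\mathcal E^b_B\cap\mathcal E^{vb}_B=\emptyset$ for every $B$; (ii) if $L\le\mathrm{diam}(\mathcal C_o(h))<\infty$ then $\mathcal E_B$ occurs for every $B\in\partial\mathcal C_o(h,L)$;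 (iii) if neighbouring boxes $B,B'$ both lie in $\mathcal C_o(h,L)$ and $\mathcal E^b_B$ occurs, then $\mathcal E_{B'}$ occurs. An interface is a finite collection $\mathcal I$ of pairwise disjoint boxes, each belonging to $L_i\mathbb Z^d$ for one of finitely many integer scales $1\le L_1<\dots<L_k$; it occurs if $\mathcal E_B$ (for the family of the scale of $B$) occurs for every $B\in\mathcal I$. $\mathcal B(\mathcal I)$ (resp. $\mathcal{VB}(\mathcal I)$) is the set of $B\in\mathcal I$ for which $\mathcal E^b_B$ (resp. $\mathcal E^{vb}_B$) occurs. *)

(* Defs.v *)
From HB Require Import structures.
From mathcomp Require Import all_boot all_order all_algebra.
From mathcomp Require Import all_classical all_reals all_analysis.
Set Implicit Arguments.
Unset Strict Implicit.
Unset Printing Implicit Defensive.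
Import Order.TTheory GRing.Theory Num.Theory numFieldNormedType.Exports.
Local Open Scope ring_scope.
Local Open Scope classical_set_scope.

Definition l1dist (d : nat) (x y : 'rV[int]_d) : nat :=
  (\sum_(i < d) absz (x ord0 i - y ord0 i))%N.

Definition adjZ (d : nat) (x y : 'rV[int]_d) : bool := l1dist x y == 1%N.

Definition unitstep (d : nat) (i : 'I_d) (s : bool) : 'rV[int]_d :=
  \row_(j < d) (if j == i then (if s then 1 else -1) else 0).

Definition clusterO (d : nat) (R : realType) (phi : 'rV[int]_d -> R) (h : R)
  : set 'rV[int]_d :=
  [set y | exists p : seq 'rV[int]_d,
     [/\ path (@adjZ d) 0 p, last 0 p = y & all (fun v => h <= phi v) (0 :: p)]].

Definition gdiam (d : nat) (R : realType) (C : set 'rV[int]_d) : \bar R :=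
  ereal_sup [set r | exists x y, [/\ C x, C y & r = ((l1dist x y)%:R)%:E]].

Definition vclosure (d : nat) (S : set 'rV[int]_d) : set 'rV[int]_d :=
  [set x | S x \/ exists y, S y /\ adjZ x y].

(* noret K n x = P_x[ X_m \notin K for all 1 <= m <= n ] for simple random walk *)
Fixpoint noret (d : nat) (R : realType) (K : set 'rV[int]_d) (n : nat)
    (x : 'rV[int]_d) {struct n} : R :=
  match n with
  | 0 => 1
  | m.+1 => ((2 * d)%:R)^-1 *
      \sum_(i < d) \sum_(s : bool)
        (if (x + unitstep i s) \in K then 0 else noret R K m (x + unitstep i s))
  end.

(* P_x[ \tilde H_K = oo ] *)
Definition escZ (d : nat) (R : realType) (K : set 'rV[int]_d) (x : 'rV[int]_d) : R :=
  limn (fun n => noret R K n x).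

(* capZ(K) = sum_{x in K} 2d P_x[\tilde H_K = oo]  (K finite) *)
Definition capZ (d : nat) (R : realType) (K : set 'rV[int]_d) : R :=
  \sum_(x \in K) (2 * d)%:R * escZ R K x.

Definition A_event (d : nat) (R : realType) (Omega : Type)
    (phi : Omega -> 'rV[int]_d -> R) (h : R) (N : nat) (w : Omega) : Prop :=
  finite_set (clusterO (phi w) h) /\
  (N%:R - 1 <= capZ R (vclosure (clusterO (phi w) h)) /\
   capZ R (vclosure (clusterO (phi w) h)) < N%:R).

Definition boxL (d : nat) (L : nat) (z : 'rV[int]_d) : set 'rV[int]_d :=
  [set x | forall i, z ord0 i <= x ord0 i < z ord0 i + L%:Z].

Definition inLZ (d : nat) (L : nat) (z : 'rV[int]_d) : Prop :=
  forall i, (L%:Z %| z ord0 i)%Z.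

Definition coarse (d : nat) (C : set 'rV[int]_d) (L : nat) : set 'rV[int]_d :=
  [set z | inLZ L z /\ exists x, C x /\ boxL L z x].

(* \partial S for a set S of boxes of L Z^d (given by their corners) *)
Definition boxbd (d : nat) (S : set 'rV[int]_d) (L : nat) : set 'rV[int]_d :=
  [set z | S z /\ exists w, [/\ inLZ L w, l1dist z w = L & ~ S w]].

Definition admissible (d : nat) (R : realType) (Omega : Type)
    (phi : Omega -> 'rV[int]_d -> R) (h : R) (L : nat)
    (Eb Evb : 'rV[int]_d -> Omega -> Prop) : Prop :=
  [/\ (forall z w, inLZ L z -> ~ (Eb z w /\ Evb z w)),
      (forall w, (L%:R%:E <= gdiam R (clusterO (phi w) h))%E ->
         (gdiam R (clusterO (phi w) h) < +oo)%E ->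
         forall z, boxbd (coarse (clusterO (phi w) h) L) L z -> Eb z w \/ Evb z w)
    & (forall w z z', inLZ L z -> inLZ L z' -> l1dist z z' = L ->
         coarse (clusterO (phi w) h) L z -> coarse (clusterO (phi w) h) L z' ->
         Eb z w -> Eb z' w \/ Evb z' w)].

(* An interface: a nonempty finite list of distinct, pairwise disjoint boxes,
   each given as (scale L >= 1, corner z \in L Z^d). *)
Definition is_interface (d : nat) (I : seq (nat * 'rV[int]_d)) : Prop :=
  [/\ I != [::], uniq I,
      (forall a, a \in I -> (0 < a.1)%N /\ inLZ a.1 a.2)
    & (forall a b, a \in I -> b \in I -> a != b ->
         boxL a.1 a.2 `&` boxL b.1 b.2 = set0)].

Definition min_scale (d : nat) (I : seq (nat * 'rV[int]_d)) : nat :=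
  foldr minn (head 0%N (map fst I)) (map fst I).
Definition max_scale (d : nat) (I : seq (nat * 'rV[int]_d)) : nat :=
  (\max_(a <- I) a.1)%N.

Definition occursI (d : nat) (Omega : Type)
    (Eb Evb : nat -> 'rV[int]_d -> Omega -> Prop)
    (I : seq (nat * 'rV[int]_d)) (w : Omega) : Prop :=
  forall a, a \in I -> Eb a.1 a.2 w \/ Evb a.1 a.2 w.

Definition nbad (d : nat) (Omega : Type)
    (Eb : nat -> 'rV[int]_d -> Omega -> Prop)
    (I : seq (nat * 'rV[int]_d)) (w : Omega) : nat :=
  count (fun a => `[< Eb a.1 a.2 w >]) I.

Definition vb_union (d : nat) (Omega : Type)
    (Evb : nat -> 'rV[int]_d -> Omega -> Prop)
    (I : seq (nat * 'rV[int]_d)) (w : Omega) : set 'rV[int]_d :=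
  [set x | exists2 a, a \in I & Evb a.1 a.2 w /\ boxL a.1 a.2 x].

(* Main.v *)
Require Import Defs.
From HB Require Import structures.
From mathcomp Require Import all_boot all_order all_algebra.
From mathcomp Require Import all_classical all_reals all_analysis.
From mathcomp Require Import finmap lra ring zify.
Import Order.TTheory GRing.Theory Num.Theory numFieldNormedType.Exports.
Local Open Scope ring_scope.
Local Open Scope classical_set_scope.

(** Only the scales [2^j] with [2^j0 <= 2^j <= diam C] are used, where [C] is the
    cluster of the origin.  At the top scale [2^k <= diam C < 2^(k+1)] the cluster
    meets at most [4^d] boxes.  Going down in scale, bad boxes are replaced by their
    [2^d] children and very bad boxes are kept.  If at some scale there are at least
    [t N 2^(-j rho)] boxes all of whose ancestors (including themselves) are bad, stop
    at the first such scale and take these boxes: this is (c2).  Otherwise take all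
    the very bad boxes met on the way.  By admissibility these, together with the
    remaining bad boxes of scale [2^j0], separate [C] from infinity, and the latter
    are too few to have capacity of order [N]: this is (c1).  In both cases the
    number of boxes explored is at most [4^d] plus a geometric sum, hence a small
    multiple of [t N] once [j0] is large, so that an interface is encoded by [k] and
    [O(delta t N)] labels.  There are only polynomially many choices of [k] since a
    connected set of diameter [2 m^5] has capacity at least [c m].

    Capacity is handled through [hit K n y = P_y[H_K <= n]]: by time reversal,
    [sum_y hit K n y] is the sum over [m <= n] of [sum_(x in K) P_x[no return to K
    before m]], so [2 d n^-1 sum_y hit K n y] tends to the capacity of [K], and
    comparisons between capacities follow from pointwise comparisons of hitting
    probabilities outside a finite set.  *)

(* The library's [adjZ], on adjugate matrices, shadows the adjacency relation. *)
Local Notation adjZ := Defs.adjZ.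

(** * Hitting probabilities and capacity *)

Section RandomWalk.
Context {R : realType} {d : nat}.
Local Notation Z := 'rV[int]_d.
Implicit Types (K : set Z) (f g : Z -> R) (x y : Z).

Lemma l1distE x y : l1dist x y = (\sum_(i < d) absz (x ord0 i - y ord0 i)%R)%N.
Proof. by []. Qed.

Lemma adjZP x y : adjZ x y -> exists i s, y = x + unitstep i s.
Proof.
move=> /eqP xy1; pose D j := absz (x ord0 j - y ord0 j)%R.
have [j Dj] : exists j, (0 < D j)%N.
  apply: contrapT => noj; suff : l1dist x y = 0%N by rewrite xy1.
  rewrite /l1dist big1// => j _; case: (posnP (D j)) => // Dj.
  by case: noj; exists j.
move: xy1; rewrite l1distE (bigD1 j)//= -/(D j) => sum1.
have Dj1 : D j = 1%N by lia.
have D0 i : i != j -> D i = 0%N.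
  move=> ij; apply/eqP; rewrite -leqn0.
  by move: sum1; rewrite (bigD1 i)//= -/(D i); lia.
exists j, (x ord0 j < y ord0 j); apply/matrixP => o i; rewrite (ord1 o) !mxE.
have -> : 0 = ord0 :> 'I_1 by apply/val_inj.
case: eqVneq => [->|/D0].
  have step (a b : int) : absz (a - b)%R = 1%N -> b = a + (if a < b then 1 else -1).
    by case: ltP; lia.
  exact: step.
have stay (a b : int) : absz (a - b)%R = 0%N -> b = a + 0 by lia.
exact: stay.
Qed.

Hypothesis d_gt0 : (0 < d)%N.

Definition avg f x : R :=
  ((2 * d)%:R)^-1 * \sum_(i < d) \sum_(s : bool) f (x + unitstep i s).

Fixpoint hit K (n : nat) x : R :=
  match n with
  | 0 => (x \in K)%:R
  | m.+1 => if x \in K then 1 else avg (hit K m) x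
  end.

(** The probability P_x[H_K = n] that the first visit to [K], time 0 included, happens at time
    [n]. *)
Fixpoint first_hit K (n : nat) x : R :=
  match n with
  | 0 => (x \in K)%:R
  | m.+1 => if x \in K then 0 else avg (first_hit K m) x
  end.

(** By time reversal this is also the sum over all starting points [x] of P_x[H_K = n]; multiplied
    by [2 d] it converges to the capacity. *)
Definition escape K (n : nat) : R := \sum_(x \in K) noret R K n x.

Lemma noretS K n x :
  noret R K n.+1 x = avg (fun y => if y \in K then 0 else noret R K n y) x.
Proof. by []. Qed.

Lemma eq_avg f g x : f =1 g -> avg f x = avg g x.
Proof. by move=> fg; congr (_ * _); apply: eq_bigr => i _; apply: eq_bigr => s _. Qed.

Lemma avg_le f g x :
  (forall i s, f (x + unitstep i s) <= g (x + unitstep i s)) -> avg f x <= avg g x.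
Proof.
move=> fg; rewrite ler_wpM2l ?invr_ge0 ?ler0n//.
by apply: ler_sum => i _; apply: ler_sum => s _.
Qed.

Lemma avgD f g x : avg (fun y => f y + g y) x = avg f x + avg g x.
Proof.
rewrite /avg -mulrDr -big_split /=; congr (_ * _); apply: eq_bigr => i _.
by rewrite big_split.
Qed.

Lemma avg_cst (c : R) x : avg (fun=> c) x = c.
Proof.
have d0 : ((2 * d)%:R : R) != 0 by rewrite pnatr_eq0 muln_eq0 negb_or /= -lt0n d_gt0.
rewrite /avg; under eq_bigr do rewrite big_bool /=.
rewrite sumr_const card_ord -mulr2n -mulrnA.
by rewrite -[c *+ _]mulr_natl mulrA mulVf ?mul1r.
Qed.

Lemma avgZ (c : R) f x : avg (fun y => c * f y) x = c * avg f x.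
Proof.
rewrite /avg mulrCA; congr (_ * _); rewrite mulr_sumr; apply: eq_bigr => i _.
by rewrite mulr_sumr.
Qed.

Lemma avg_ge0 f x : (forall y, 0 <= f y) -> 0 <= avg f x.
Proof. by move=> f0; rewrite -(avg_cst 0 x); apply: avg_le. Qed.

Lemma avg_sum (I : Type) (r : seq I) (F : I -> Z -> R) x :
  avg (fun y => \sum_(j <- r) F j y) x = \sum_(j <- r) avg (F j) x.
Proof.
elim: r => [|j r IH].
  by rewrite big_nil -[RHS](avg_cst 0 x); apply: eq_avg => y; rewrite big_nil.
by rewrite big_cons -IH -avgD; apply: eq_avg => y; rewrite big_cons.
Qed.

Lemma avg_ge_step f x i s : (forall y, 0 <= f y) ->
  ((2 * d)%:R)^-1 * f (x + unitstep i s) <= avg f x.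
Proof.
move=> f0; rewrite ler_wpM2l ?invr_ge0 ?ler0n//.
rewrite (bigD1 i)//= (bigD1 s)//= -addrA lerDl addr_ge0 ?sumr_ge0// => j _.
by rewrite sumr_ge0.
Qed.

Lemma noret_ge0 K n x : 0 <= noret R K n x.
Proof. by elim: n x => [|n IH] x //; rewrite noretS avg_ge0// => y; case: ifP. Qed.

Lemma noret_le1 K n x : noret R K n x <= 1.
Proof.
elim: n x => [|n IH] x //; rewrite noretS -[leRHS](avg_cst 1 x) avg_le// => i s.
by case: ifP.
Qed.

Lemma noret_nonincreasing K x : nonincreasing_seq (noret R K ^~ x).
Proof.
apply/nonincreasing_seqP => n; elim: n x => [|n IH] x; first exact: noret_le1.
by rewrite (noretS _ n) (noretS _ n.+1) avg_le// => i s; case: ifP.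
Qed.

Lemma hit_ge0 K n x : 0 <= hit K n x.
Proof. by elim: n x => [|n IH] x //=; case: ifP => // _; apply: avg_ge0. Qed.

Lemma hit_in K n x : x \in K -> hit K n x = 1.
Proof. by case: n => [|n] /= ->. Qed.

Lemma hit_le1 K n x : hit K n x <= 1.
Proof.
elim: n x => [|n IH] x /=; first by case: (x \in K).
by case: ifP => // _; rewrite -[leRHS](avg_cst 1 x) avg_le.
Qed.

Lemma first_hit_ge0 K n x : 0 <= first_hit K n x.
Proof. by elim: n x => [|n IH] x //=; case: ifP => // _; apply: avg_ge0. Qed.

Lemma hit_sum K n x : hit K n x = \sum_(m < n.+1) first_hit K m x.
Proof.
elim: n x => [|n IH] x; first by rewrite big_ord1.
rewrite big_ord_recl /=; case: ifPn => xK.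
  by rewrite big1 ?addr0.
by rewrite add0r -avg_sum; apply: eq_avg.
Qed.

Lemma unitstepN i s : - unitstep i s = unitstep i (~~ s) :> Z.
Proof.
apply/rowP => j; rewrite !mxE; case: ifP => _; last by rewrite oppr0.
by case: s; rewrite /= ?opprK.
Qed.

Lemma bij_addr x : set_bij [set: Z] [set: Z] (+%R x).
Proof.
split; [by [] | by move=> y z _ _ /addrI | move=> y _ /=].
by exists (y - x) => //; rewrite addrC subrK.
Qed.

Lemma esum_shift (f : Z -> \bar R) x :
  \esum_(y in setT) f (x + y) = \esum_(y in setT) f y.
Proof. by rewrite [RHS](reindex_esum setT setT (+%R x))//; apply: bij_addr. Qed.

(** Reversibility: the step operator is self-adjoint for the counting measure, because a step and
    its opposite are equally likely. Nonnegativity gives the infinite sums a meaning without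
    summability. *)
Lemma esum_avg f g : (forall x, 0 <= f x) -> (forall x, 0 <= g x) ->
  \esum_(x in setT) (f x * avg g x)%:E = \esum_(x in setT) (avg f x * g x)%:E.
Proof.
move=> f0 g0; pose c : R := ((2 * d)%:R)^-1.
have c0 : 0 <= c by rewrite invr_ge0 ler0n.
have expand (F : Z -> 'I_d -> bool -> R) : (forall x i s, 0 <= F x i s) ->
    \esum_(x in setT) (\sum_i \sum_s F x i s)%:E =
    (\sum_i \sum_s \esum_(x in setT) (F x i s)%:E)%E.
  move=> F0; transitivity (\esum_(x in setT) \sum_i \sum_s (F x i s)%:E)%E.
    by apply: eq_esum => x _; rewrite -sumEFin; apply: eq_bigr => i _; rewrite sumEFin.
  rewrite esum_sum; last by move=> x i _ _; apply: sume_ge0 => s _; rewrite lee_fin.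
  by apply: eq_bigr => i _; rewrite esum_sum// => x s _ _; rewrite lee_fin.
transitivity (\esum_(x in setT)
    (\sum_(i < d) \sum_s (c * f x * g (x + unitstep i s)))%:E).
  apply: eq_esum => x _; congr EFin; rewrite /avg mulrCA mulrA mulr_sumr.
  by apply: eq_bigr => i _; rewrite mulr_sumr.
transitivity (\esum_(x in setT)
    (\sum_(i < d) \sum_s (c * f (x + unitstep i s) * g x))%:E); last first.
  apply: eq_esum => x _; congr EFin; rewrite /avg -mulrA mulr_suml mulr_sumr.
  apply: eq_bigr => i _; rewrite mulr_suml mulr_sumr; apply: eq_bigr => s _.
  by rewrite mulrA.
rewrite !expand; last 2 first.
- by move=> x i s; rewrite !mulr_ge0.
- by move=> x i s; rewrite !mulr_ge0.
have swap i s : \esum_(x in setT) (c * f x * g (x + unitstep i s))%:E =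
    \esum_(x in setT) (c * f (x + unitstep i (~~ s)) * g x)%:E.
  rewrite -[RHS](esum_shift _ (unitstep i s)); apply: eq_esum => x _.
  by rewrite -unitstepN [unitstep i s + x]addrC addrK.
by apply: eq_bigr => i _; rewrite !big_bool /= addeC !swap.
Qed.

Lemma esum_indicator K f : finite_set K -> (forall x, 0 <= f x) ->
  \esum_(x in setT) (f x * (x \in K)%:R)%:E = (\sum_(x \in K) f x)%:E.
Proof.
move=> finK f0; transitivity (\esum_(x in K) (f x)%:E).
  rewrite [RHS]esum_mkcond; apply: eq_esum => x _.
  by case: ifP => _; rewrite ?mulr1 ?mulr0.
rewrite esum_fset//; first by rewrite !fsbig_finite// sumEFin.
by move=> x _; rewrite lee_fin.
Qed.

Lemma esum_first_hit K n : finite_set K ->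
  \esum_(x in setT) (first_hit K n x)%:E = (escape K n)%:E.
Proof.
(* One factor [avg] at a time is moved from [first_hit] to [noret]: the restriction to the
   complement of [K] that [first_hit] imposes before a step is the one that [noret] imposes after
   it. *)
move=> finK; suff shift m : \esum_(x in setT) (noret R K m x * first_hit K n x)%:E =
    \esum_(x in setT) (noret R K (n + m) x * first_hit K 0 x)%:E.
  transitivity (\esum_(x in setT) (noret R K 0 x * first_hit K n x)%:E).
    by apply: eq_esum => x _; rewrite mul1r.
  by rewrite shift addn0 esum_indicator//; apply: noret_ge0.
elim: n m => [|n IH] m //; rewrite addSnnS -IH.
rewrite -[RHS]/(\esum_(x in setT)
  (avg (fun y => if y \in K then 0 else noret R K m y) x * first_hit K n x)%:E).
rewrite -esum_avg; last by exact: first_hit_ge0.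
  by apply: eq_esum => x _ /=; case: ifP; rewrite ?mul0r ?mulr0.
by move=> x; case: ifP => // _; apply: noret_ge0.
Qed.

Lemma esum_hit K n : finite_set K ->
  \esum_(x in setT) (hit K n x)%:E = (series (escape K) n.+1)%:E.
Proof.
move=> finK; rewrite /series /= big_mkord.
transitivity (\esum_(x in setT) \sum_(m < n.+1) (first_hit K m x)%:E)%E.
  by apply: eq_esum => x _; rewrite hit_sum sumEFin.
rewrite esum_sum; last by move=> x m _ _; rewrite lee_fin first_hit_ge0.
by rewrite -sumEFin; apply: eq_bigr => m _; rewrite esum_first_hit.
Qed.

Lemma cvg_sumr (I : Type) (r : seq I) (P : pred I) (u : I -> R^nat) (a : I -> R) :
  (forall i, P i -> u i @ \oo --> a i) ->
  (fun n => \sum_(i <- r | P i) u i n) @ \oo --> \sum_(i <- r | P i) a i.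
Proof. by move=> ua; apply: cvg_big => //; exact: add_continuous. Qed.

Lemma cvg_noret K x : noret R K n x @[n --> \oo] --> escZ R K x.
Proof.
apply: nonincreasing_is_cvgn; first exact: noret_nonincreasing.
by exists 0 => _ [n _ <-]; apply: noret_ge0.
Qed.

Lemma cvg_escape K : finite_set K -> (2 * d)%:R * escape K n @[n --> \oo] --> capZ R K.
Proof.
move=> finK; rewrite /capZ -mulr_fsumr; apply: cvgMl_tmp.
have -> : escape K = (fun n => \sum_(x <- fset_set K) noret R K n x).
  by apply/funext => n; rewrite /escape fsbig_finite.
by rewrite fsbig_finite//; apply: cvg_sumr => x _; apply: cvg_noret.
Qed.

Lemma escape_le K n : finite_set K -> escape K n <= escape K 0.
Proof.
move=> finK; rewrite /escape !fsbig_finite//.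
by apply: ler_sum => x _; apply: noret_le1.
Qed.

(** Cesàro means keep the limits, and the bounded error [c] disappears after division by [n.+1]. *)
Lemma le_cvg_series (u v : R^nat) (a b c : R) : u @ \oo --> a -> v @ \oo --> b ->
  (forall n, series u n.+1 <= series v n.+1 + c) -> a <= b.
Proof.
move=> ua vb uv; rewrite -[b]addr0.
have n0 : (fun n => n.+1%:R^-1 * c : R) @ \oo --> (0 : R).
  by rewrite -[0](mul0r c); apply: cvgMr_tmp; exact: cvg_harmonic.
apply: (ler_cvg_to (cesaro ua) (cvgD (cesaro vb) n0)).
near=> n; rewrite /= /arithmetic_mean /= -mulrDr ler_wpM2l//.
Unshelve. all: by end_near. Qed.

Lemma hit_leS K n x : hit K n x <= hit K n.+1 x.
Proof. by rewrite !hit_sum [leRHS]big_ord_recr lerDl first_hit_ge0. Qed.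

(** Summing the pointwise bound over space gives partial sums of [escape]. The finitely many points
    of [A] and the delay by one step cost a bounded amount, which averaging over time removes. *)
Lemma cap_le_sum K (Ks : seq (set Z)) (A : set Z) : finite_set K ->
  (forall K', K' \in Ks -> finite_set K') -> finite_set A ->
  (forall n x, ~ A x -> hit K n x <= \sum_(K' <- Ks) hit K' n.+1 x) ->
  capZ R K <= \sum_(K' <- Ks) capZ R K'.
Proof.
move=> finK finKs finA hitle.
pose c := \sum_(x \in A) (1 : R); pose c' := \sum_(K' <- Ks) escape K' 0.
have ser n : series (escape K) n.+1 <= \sum_(K' <- Ks) series (escape K') n.+2 + c.
  rewrite -lee_fin EFinD -esum_hit// -sumEFin -[c%:E]esum_indicator//.
  rewrite big_seq.
  have -> : (\sum_(K' <- Ks | K' \in Ks) (series (escape K') n.+2)%:E =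
      \sum_(K' <- Ks | K' \in Ks) \esum_(x in setT) (hit K' n.+1 x)%:E)%E.
    by apply: eq_bigr => K' K's; rewrite esum_hit//; apply: finKs.
  rewrite -big_seq -esum_sum; last by move=> x K' _ _; rewrite lee_fin hit_ge0.
  rewrite -esumD; last 2 first.
  - by move=> x _; rewrite sume_ge0// => K' _; rewrite lee_fin hit_ge0.
  - by move=> x _; rewrite lee_fin mul1r.
  apply: le_esum => x _; rewrite sumEFin -EFinD lee_fin mul1r.
  case: (boolP (x \in A)) => [xA|]; last by rewrite notin_setE addr0 => /hitle.
  by rewrite (le_trans (hit_le1 _ _ _))// lerDr sumr_ge0// => K' _; apply: hit_ge0.
have cvgKs : (fun n => \sum_(K' <- Ks) (2 * d)%:R * escape K' n) @ \oo -->
    \sum_(K' <- Ks) capZ R K'.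
  rewrite big_seq.
  have -> : (fun n => \sum_(K' <- Ks) (2 * d)%:R * escape K' n) =
      (fun n => \sum_(K' <- Ks | K' \in Ks) (2 * d)%:R * escape K' n).
    by apply/funext => n; rewrite big_seq.
  by apply: cvg_sumr => K' K's; apply: cvg_escape; apply: finKs.
apply: (le_cvg_series _ _ _ _ ((2 * d)%:R * (c' + c)) (cvg_escape _ finK) cvgKs) => n.
rewrite /series /= -mulr_sumr exchange_big /=.
under [X in _ <= X + _]eq_bigr do rewrite -mulr_sumr.
rewrite -mulr_sumr -mulrDr ler_wpM2l//.
apply: (le_trans (ser n)); rewrite addrA lerD2r -big_split /=.
rewrite big_seq [leRHS]big_seq; apply: ler_sum => K' K's.
by rewrite /series /= big_nat_recr//= lerD2l escape_le//; apply: finKs.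
Qed.

Lemma cap_le K K' : finite_set K' -> K `<=` K' -> capZ R K <= capZ R K'.
Proof.
move=> finK' KK'; have finK := sub_finite_set KK' finK'.
have -> : capZ R K' = \sum_(S <- [:: K']) capZ R S by rewrite big_seq1.
apply: (cap_le_sum _ _ set0) => //; first by move=> _ /[!inE] /eqP ->.
move=> n x _; rewrite big_seq1; apply: le_trans (hit_leS _ _ _).
elim: n x => [|n IH] x /=.
  by case: (boolP (x \in K)) => [/set_mem/KK'/mem_set -> //|_]; apply: ler0n.
case: ifPn => [/set_mem/KK'/mem_set -> //|_].
case: ifPn => _; last exact: avg_le.
by rewrite -[leRHS](avg_cst 1 x) avg_le// => *; apply: hit_le1.
Qed.

Lemma capU K K' : finite_set K -> finite_set K' ->
  capZ R (K `|` K') <= capZ R K + capZ R K'.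
Proof.
move=> finK finK'; have -> : capZ R K + capZ R K' = \sum_(S <- [:: K; K']) capZ R S.
  by rewrite !big_cons big_nil addr0.
apply: (cap_le_sum _ _ set0); rewrite ?finite_setU//.
  by move=> _ /[!inE] /orP[] /eqP ->.
move=> n x _; rewrite !big_cons big_nil addr0.
apply: le_trans (lerD (hit_leS _ _ _) (hit_leS _ _ _)).
elim: n x => [|n IH] x /=; rewrite in_setU; case: (x \in K); case: (x \in K') => //=;
  rewrite ?addr0 ?add0r ?lerDl ?lerDr ?avg_ge0// => *; rewrite ?hit_ge0//.
by rewrite -avgD; apply: avg_le.
Qed.

Lemma cap_le_size K (s : seq Z) : K `<=` [set` s] -> capZ R K <= (2 * d * size s)%:R.
Proof.
move=> Ks; have finK : finite_set K by apply: sub_finite_set Ks _; apply: finite_seq.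
rewrite /capZ fsbig_finite//.
have esc1 x : escZ R K x <= 1.
  apply: le_trans (nonincreasing_cvgn_ge (noret_nonincreasing K x) _ 0) _ => //.
  exact: cvgP (cvg_noret K x).
have -> : (2 * d * size s)%:R = (size s)%:R * (2 * d)%:R :> R by rewrite mulnC natrM.
apply: (@le_trans _ _ (\sum_(x <- fset_set K) (2 * d)%:R)).
  by apply: ler_sum => x _; rewrite ler_piMr.
rewrite big_const_seq count_predT iter_addr addr0 -[leLHS]mulr_natl.
rewrite ler_wpM2r// ler_nat.
apply: uniq_leq_size => // x; rewrite in_fset_set// => /set_mem/Ks; exact.
Qed.

(** From a point of the closure the walk is in [K] now or after one step with probability at least
    [1 / (2 d)]. The extra step is the delay that [cap_le_sum] tolerates. *)
Lemma cap_vclosure K : finite_set K -> finite_set (vclosure K) ->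
  capZ R (vclosure K) <= (2 * d)%:R * capZ R K.
Proof.
move=> finK finV.
(* The factor [2 d] is expressed as [2 d] copies of [K], to fit [cap_le_sum]. *)
have -> : (2 * d)%:R * capZ R K = \sum_(S <- nseq (2 * d) K) capZ R S.
  by rewrite big_nseq iter_addr addr0 mulr_natl.
apply: (cap_le_sum _ _ set0) => //; first by move=> _ /nseqP[-> _].
have d0 : 0 < (2 * d)%:R :> R by rewrite ltr0n muln_gt0.
move=> n x _; rewrite big_nseq iter_addr addr0 -mulr_natl.
have near_ge m y : y \in vclosure K -> 1 <= (2 * d)%:R * hit K m.+1 y.
  move=> /set_mem yV; case: (boolP (y \in K)) => [yK|yK].
    by rewrite hit_in// mulr1 ler1n muln_gt0.
  case: yV => [/mem_set/(negP yK) //|[z [zK /adjZP[i [s zE]]]]].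
  rewrite -ler_pdivrMl// mulr1 /= (negbTE yK).
  apply: le_trans (avg_ge_step _ _ i s (hit_ge0 K m)).
  by rewrite -zE hit_in ?mulr1 ?mem_set.
elim: n x => [|n IH] x; rewrite [leLHS]/=; case: (boolP (x \in _)) => [/near_ge //|xV].
  by rewrite mulr_ge0// hit_ge0.
rewrite [hit K _ _]/=; case: ifPn => [_|_].
  rewrite mulr1; apply: le_trans (_ : 1 <= _); last by rewrite ler1n muln_gt0.
  by rewrite -[leRHS](avg_cst 1 x) avg_le// => *; apply: hit_le1.
by rewrite -avgZ; apply: avg_le => *; apply: IH.
Qed.

End RandomWalk.

(** * Capacity of well separated points *)

Section CapacityLowerBound.
Context {R : realType} {d : nat}.
Hypothesis d_ge3 : (3 <= d)%N.
Local Notation Z := 'rV[int]_d.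
Implicit Types (K : set Z) (x y : Z).
Let d_gt0 : (0 < d)%N. Proof. exact: leq_trans d_ge3. Qed.

(** The function [w] dominates [q] times the expected number of visits to [s]. As [w] is at most 1
    on [s], these expectations are at most the hitting probabilities; summed over space, each unit
    of time contributes [q |s|]. *)
Lemma card_le_cap (s : seq Z) (w : Z -> R) (q : R) : uniq s -> 0 <= q ->
  (forall x, 0 <= w x) -> (forall x, q * (x \in s)%:R + avg w x <= w x) ->
  (forall x, x \in s -> w x <= 1) -> (2 * d)%:R * (q * (size s)%:R) <= capZ R [set` s].
Proof.
move=> us q0 w0 superw w1; set K := [set` s].
have finK : finite_set K by exact: finite_seq.
have inK x : (x \in K) = (x \in s) by rewrite mem_setE.
(* [v n] is [q] times the expected number of visits to [s] at times before [n]. *)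
pose v := fix v n x : R :=
  if n is m.+1 then q * (x \in s)%:R + avg (v m) x else 0.
have vS n x : v n.+1 x = q * (x \in s)%:R + avg (v n) x by [].
have v0 n x : 0 <= v n x.
  by elim: n x => [|n IH] x //=; rewrite addr_ge0 ?avg_ge0// mulr_ge0.
have vw n x : v n x <= w x.
  elim: n x => [|n IH] x //=; apply: le_trans (superw x).
  by rewrite lerD2l avg_le.
have v_hit n x : v n.+1 x <= hit K n x.
  elim: n x => [|n IH] x.
    case: (boolP (x \in K)) => xK; first by rewrite hit_in// (le_trans (vw _ _)) ?w1 -?inK.
    by rewrite /= -inK (negbTE xK) mulr0 add0r (avg_cst d_gt0).
  case: (boolP (x \in K)) => xK; first by rewrite hit_in// (le_trans (vw _ _)) ?w1 -?inK.
  by rewrite vS [hit _ _ _]/= -inK (negbTE xK) mulr0 add0r avg_le.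
have esum_v n : \esum_(x in setT) (v n x)%:E = (q * (size s)%:R *+ n)%:E.
  elim: n => [|n IH]; first by rewrite mulr0n esum1.
  have -> : \esum_(x in setT) (v n.+1 x)%:E =
      \esum_(x in setT) ((q * (x \in K)%:R)%:E + (1 * avg (v n) x)%:E)%E.
    by apply: eq_esum => x _; rewrite -EFinD mul1r inK.
  rewrite esumD; last 2 first.
  - by move=> x _; rewrite lee_fin mulr_ge0.
  - by move=> x _; rewrite lee_fin mul1r avg_ge0.
  rewrite esum_indicator// (@esum_avg R d (fun=> 1))//.
  under eq_esum do rewrite (avg_cst d_gt0) mul1r.
  rewrite IH -EFinD -fsbig_seq// big_const_seq count_predT iter_addr addr0.
  by rewrite mulr_natr mulrS.
pose c : R^nat := fun=> (2 * d)%:R * (q * (size s)%:R).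
have c_cvg : c @ \oo --> (2 * d)%:R * (q * (size s)%:R) by exact: cvg_cst.
apply: (le_cvg_series c _ _ _ 0 c_cvg (cvg_escape d_gt0 K finK)) => n.
rewrite /c addr0 /series /= sumr_const_nat subn0 -mulr_sumr -mulrnAr.
rewrite ler_wpM2l// -lee_fin -esum_v -esum_hit//.
by apply: le_esum => x _; rewrite lee_fin.
Qed.

(* [3 / 16], instead of the Taylor coefficient [5 / 32] of [(1 + u)^(-1/4)], is the
   largest second order coefficient that superharmonicity in dimension 3 affords. *)
Lemma quartic_lower_bound (u : R) : `|u| <= 1 / 8 ->
  1 <= (1 + u) * (1 - u / 4 + 3 * u ^+ 2 / 16) ^+ 4.
Proof.
move=> hu; pose a := - (1 / 4) + 3 * u / 16.
have -> : 1 - u / 4 + 3 * u ^+ 2 / 16 = 1 + u * a by rewrite /a; field.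
have prod (y z b c : R) : `|y| <= b -> `|z| <= c -> `|y * z| <= b * c.
  by move=> yb zc; rewrite normrM ler_pM.
have /andP[ul ur] : - (1 / 8) <= u <= 1 / 8 by rewrite -ler_norml.
have ha : `|a| <= 2 / 7 by rewrite ler_norml /a; apply/andP; split; lra.
have ha2 := prod _ _ _ _ ha ha; have ha3 := prod _ _ _ _ ha2 ha.
have ha4 := prod _ _ _ _ ha2 ha2; have hu2 := prod _ _ _ _ hu hu.
have := prod _ _ _ _ hu ha2; have := prod _ _ _ _ hu ha3.
have := prod _ _ _ _ hu2 ha3; have := prod _ _ _ _ (prod _ _ _ _ hu2 hu) ha4.
rewrite !ler_norml => /andP[b1 _] /andP[b2 _] /andP[b3 _] /andP[b4 _].
(* By the choice of [a], the first order coefficient [1 + 4 * a] equals [3 * u / 4], so a factor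
   [u ^+ 2] splits off; [r] is the cofactor, and its small terms are controlled by [b1] to [b4]. *)
rewrite -subr_ge0; pose r := 3 / 4 + 4 * a + 6 * (a * a) + 6 * (u * (a * a))
  + 4 * (u * (a * a * a)) + 4 * (u * u * (a * a * a)) + (u * u) * (a * a * (a * a))
  + u * u * u * (a * a * (a * a)).
have -> : (1 + u) * (1 + u * a) ^+ 4 - 1 = u ^+ 2 * r.
  have -> : (1 + u) * (1 + u * a) ^+ 4 - 1 =
    u * (1 + 4 * a - 3 / 4 * u) + u ^+ 2 * r by rewrite /r; ring.
  by rewrite /a; field.
rewrite mulr_ge0 ?sqr_ge0// /r.
have : 0 <= (u * u) * (a * a * (a * a)).
  by rewrite -!expr2 mulr_ge0// ?sqr_ge0.
have : 4 * a + 6 * (a * a) = - (5 / 8) + 3 / 16 * u + 27 / 128 * (u * u).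
  by rewrite /a; field.
have := sqr_ge0 u; rewrite expr2; lra.
Qed.

Definition root4 (q : R) : R := Num.sqrt (Num.sqrt q).

Lemma root4_gt0 q : 0 < q -> 0 < root4 q.
Proof. by move=> q0; rewrite !sqrtr_gt0. Qed.

Lemma root4K q : 0 <= q -> root4 q ^+ 4 = q.
Proof.
by move=> q0; rewrite (exprM _ 2 2) sqr_sqrtr ?sqrtr_ge0// sqr_sqrtr.
Qed.

Lemma root4_le q q' : q <= q' -> root4 q <= root4 q'.
Proof. by move=> qq'; rewrite !ler_wsqrtr. Qed.

Lemma inv_root4_le (q u : R) : 0 < q -> `|u| <= 1 / 8 ->
  (root4 (q * (1 + u)))^-1 <= (root4 q)^-1 * (1 - u / 4 + 3 * u ^+ 2 / 16).
Proof.
move=> q0 hu; have /andP[ul ur] : - (1 / 8) <= u <= 1 / 8 by rewrite -ler_norml.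
have qu0 : 0 < q * (1 + u) by rewrite mulr_gt0//; lra.
set p := 1 - u / 4 + 3 * u ^+ 2 / 16.
have p0 : 0 <= p by have := sqr_ge0 u; rewrite /p; lra.
set r := root4 q; set r' := root4 (q * (1 + u)).
have r0 : 0 < r by apply: root4_gt0.
have r'0 : 0 < r' by apply: root4_gt0.
rewrite ler_pdivlMl// ler_pdivrMr// -(@ler_pXn2r _ 4) ?nnegrE ?mulr_ge0 ?(ltW r0) ?(ltW r'0)//.
rewrite exprMn !root4K ?(ltW q0) ?(ltW qu0)// mulrC -mulrA -[leLHS]mulr1 ler_wpM2l ?(ltW q0)//.
exact: quartic_lower_bound.
Qed.

Definition nsq x : R := \sum_(i < d) ((x ord0 i)%:~R) ^+ 2.

Lemma nsq_ge0 x : 0 <= nsq x.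
Proof. by apply: sumr_ge0 => i _; apply: sqr_ge0. Qed.

Lemma nsq_step x i s :
  nsq (x + unitstep i s) = nsq x + 1 + (if s then 2 else -2) * (x ord0 i)%:~R.
Proof.
rewrite /nsq (bigD1 i)//= [X in _ = X + _ + _](bigD1 i)//= !mxE eqxx.
rewrite (eq_bigr (fun j => (x ord0 j)%:~R ^+ 2)) => [|j ji]; last first.
  by rewrite !mxE (negbTE ji) addr0.
by rewrite rmorphD /=; case: s; rewrite /= ?rmorphN /=; ring.
Qed.

Lemma l1dist_le_nsq x y : (l1dist x y)%:R <= nsq (x - y).
Proof.
rewrite l1distE natr_sum; apply: ler_sum => i _; rewrite !mxE.
have sq_ge (z : int) : (absz z)%:R <= z%:~R ^+ 2 :> R.
  have -> : z%:~R ^+ 2 = (z ^+ 2)%:~R :> R by rewrite rmorphXn.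
  by rewrite pmulrn ler_int; nia.
exact: sq_ge.
Qed.

(* A stand-in for the Green function: the exponent [1/2 < d - 2] of [|x|] leaves room
   for an elementary second order estimate. *)
Definition potential x : R := (root4 (nsq x + 72))^-1.

Lemma potential_ge0 x : 0 <= potential x.
Proof. by rewrite invr_ge0 sqrtr_ge0. Qed.

(** Summed over the steps, the expansion gains [d / (2 q)] at first order and loses
    [3 (d + 4 n) / (8 q^2)] at second order. The gain wins for [d >= 3]; the terms in [n] balance
    exactly when [d = 3]. *)
Lemma potential_superharmonic x : avg potential x <= potential x.
Proof.
set n := nsq x; set q := n + 72.
have n0 : 0 <= n := nsq_ge0 x.
have q0 : 0 < q by rewrite /q; lra.
have d3 : 3 <= d%:R :> R by rewrite ler_nat.
have coord_le i : (x ord0 i)%:~R ^+ 2 <= n.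
  by rewrite /n /nsq (bigD1 i)//= lerDl sumr_ge0// => j _; apply: sqr_ge0.
(* The relative increment of [nsq x + 72] along a step. The shift 72 = 8^2 + 8 bounds it by 1/8:
   [8 (1 + 2 |z|) <= z^2 + 72] amounts to [(|z| - 8)^2 >= 0]. *)
pose u i (s : bool) : R := (1 + (if s then 2 else -2) * (x ord0 i)%:~R) / q.
have u_small i s : `|u i s| <= 1 / 8.
  have /= xi := coord_le i; set z : R := (x ord0 i)%:~R in xi *.
  rewrite /u -/z normrM normfV (gtr0_norm q0) ler_pdivrMr// ler_norml /q.
  have := sqr_ge0 (z - 8); have := sqr_ge0 (z + 8); rewrite !expr2 in xi *.
  by case: s; nra.
have step i s : potential (x + unitstep i s) <=
    potential x * (1 - u i s / 4 + 3 * u i s ^+ 2 / 16).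
  apply: le_trans (inv_root4_le q (u i s) q0 (u_small i s)).
  suff -> : q * (1 + u i s) = nsq (x + unitstep i s) + 72 by [].
  rewrite nsq_step /u mulrDr mulr1 [q * _]mulrC divfK ?lt0r_neq0// -/n /q.
  by move: (_ * _) => z; ring.
rewrite /avg ler_pdivrMl ?ltr0n ?muln_gt0//.
apply: (@le_trans _ _ (potential x * \sum_(i < d)
    (2 - (2 * q)^-1 + 3 / 8 * (1 + 4 * (x ord0 i)%:~R ^+ 2) / q ^+ 2))).
  rewrite mulr_sumr; apply: ler_sum => i _; rewrite big_bool /=.
  apply: le_trans (lerD (step i true) (step i false)) _.
  rewrite -mulrDr ler_wpM2l ?potential_ge0// le_eqVlt; apply/orP; left; apply/eqP.
  by rewrite /u; field; rewrite lt0r_neq0.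
rewrite mulrC ler_wpM2r ?potential_ge0//.
rewrite big_split /= sumr_const card_ord -mulr_suml -mulr_sumr big_split /=.
rewrite sumr_const card_ord -mulr_sumr -/(nsq x) -/n.
rewrite -[_ *+ d]mulr_natr -[1 *+ d]mulr_natr natrM mul1r.
rewrite -lerBrDl -subr_ge0.
have -> : 2 * d%:R - (2 - (2 * q)^-1) * d%:R - 3 / 8 * (d%:R + 4 * n) / q ^+ 2 =
   (d%:R * q / 2 - 3 / 8 * (d%:R + 4 * n)) / q ^+ 2.
  by field; rewrite lt0r_neq0.
by rewrite divr_ge0 ?sqr_ge0// /q; nra.
Qed.

(** The defect of harmonicity of [potential] at the origin, all of whose neighbours have [nsq] equal
    to 1. *)
Definition potential_gap : R := (root4 72)^-1 - (root4 73)^-1.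

Lemma potential_gap_gt0 : 0 < potential_gap.
Proof.
by rewrite subr_gt0 ltf_pV2 ?posrE ?root4_gt0// !ltr_sqrt ?sqrtr_gt0// ltr_nat.
Qed.

Lemma potential_gap_le x : potential_gap * (x == 0)%:R + avg potential x <= potential x.
Proof.
case: eqVneq => [->|_]; last by rewrite mulr0 add0r potential_superharmonic.
have nsq0 : nsq 0 = 0 by apply: big1 => i _; rewrite mxE expr2 mul0r.
have -> : avg potential 0 = (root4 73)^-1.
  rewrite -[RHS](avg_cst d_gt0 _ 0) /avg; congr (_ * _).
  apply: eq_bigr => i _; apply: eq_bigr => s _.
  rewrite /potential nsq_step nsq0 mxE mulr0 add0r addr0.
  by congr (root4 _)^-1; ring.
by rewrite /potential nsq0 add0r mulr1 subrK.
Qed.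

Lemma potential_le1 x : potential x <= 1.
Proof.
rewrite invf_le1; last by rewrite root4_gt0//; have := nsq_ge0 x; lra.
apply: (@le_trans _ _ (root4 1)); first by rewrite /root4 !sqrtr1.
by apply: root4_le; have := nsq_ge0 x; lra.
Qed.

Lemma potential_far x (m : nat) : (0 < m)%N -> (m ^ 4)%:R <= nsq x -> potential x <= m%:R^-1.
Proof.
move=> m0 mx; have m0' : 0 < m%:R :> R by rewrite ltr0n.
rewrite lef_pV2 ?posrE//; last by rewrite root4_gt0//; have := nsq_ge0 x; lra.
have <- : root4 (m ^ 4)%:R = m%:R.
  rewrite /root4 natrX (exprM _ 2 2) sqrtr_sqr normrX (ger0_norm (ler0n _ _)).
  by rewrite sqrtr_sqr ger0_norm.
by rewrite root4_le// (le_trans mx)// lerDl.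
Qed.

(** The test function is half the sum of the potentials centred at the points. At a point of [s],
    its own potential contributes at most 1/2 and each other one at most [1 / (2 m)], because [nsq]
    dominates the l1 distance on integer vectors; the total is at most 1. *)
Lemma separated_le_cap (s : seq Z) (m : nat) : uniq s -> size s = m ->
  {in s &, forall x y, x != y -> (m ^ 4 <= l1dist x y)%N} ->
  d%:R * potential_gap * m%:R <= capZ R [set` s].
Proof.
move=> us sm sep; have [m0|m0] := posnP m.
  rewrite m0 mulr0; apply: fsumr_ge0 => x _; rewrite mulr_ge0//.
  apply: limr_ge; first exact: cvgP (cvg_noret d_gt0 _ _).
  by apply: nearW => n; apply: noret_ge0.
pose w x : R := \sum_(y <- s) potential (x - y) / 2.
have -> : d%:R * potential_gap * m%:R = (2 * d)%:R * (potential_gap / 2 * (size s)%:R).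
  by rewrite sm natrM; field.
apply: (card_le_cap s w) => // [|x|x|x xs].
- by rewrite divr_ge0// ltW// potential_gap_gt0.
- by apply: sumr_ge0 => y _; rewrite divr_ge0 ?potential_ge0.
- have -> : (x \in s)%:R = \sum_(y <- s) (x - y == 0)%:R :> R.
    rewrite (eq_bigr (fun y => if y == x then 1 else 0)) => [|y _]; last first.
      by rewrite subr_eq0 eq_sym; case: eqP.
    by rewrite -big_mkcond big_const_seq iter_addr addr0 count_uniq_mem.
  rewrite avg_sum// mulr_sumr -big_split; apply: ler_sum => y _ /=.
  have -> : avg (fun z => potential (z - y) / 2) x = avg potential (x - y) / 2.
    rewrite -[RHS]mulrC -avgZ /avg; congr (_ * _); apply: eq_bigr => i _.
    by apply: eq_bigr => e _; rewrite mulrC addrAC.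
  by rewrite mulrAC -mulrDl ler_pM2r// potential_gap_le.
rewrite /w (bigD1_seq x)//= subrr.
apply: (@le_trans _ _ (1 / 2 + \sum_(y <- s | y != x) m%:R^-1 / 2)).
  rewrite lerD ?ler_pM2r ?potential_le1//.
  rewrite big_seq_cond [leRHS]big_seq_cond; apply: ler_sum => y /andP[ys yx].
  rewrite ler_pM2r// potential_far// (le_trans _ (l1dist_le_nsq x y))// ler_nat.
  by rewrite sep// eq_sym.
apply: (@le_trans _ _ (1 / 2 + \sum_(y <- s) m%:R^-1 / 2)).
  rewrite lerD2l [leRHS](bigID (fun y => y != x)) /= lerDl; apply: sumr_ge0 => y _.
  by apply: divr_ge0; rewrite ?invr_ge0.
rewrite big_const_seq count_predT iter_addr addr0 sm -[_ *+ m]mulr_natr.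
by rewrite mulrAC mulVf ?pnatr_eq0 -?lt0n//; lra.
Qed.

End CapacityLowerBound.

(** * Clusters and boxes *)

Section Clusters.
Context {d : nat}.
Local Notation Z := 'rV[int]_d.
Implicit Types (C : set Z) (x y z : Z).

Lemma l1dist_triangle x y z : (l1dist x z <= l1dist x y + l1dist y z)%N.
Proof.
rewrite /l1dist -big_split; apply: leq_sum => i _.
have tri (a b c : int) : (absz (a - c)%R <= absz (a - b)%R + absz (b - c)%R)%N by lia.
exact: tri.
Qed.

Lemma l1distC x y : l1dist x y = l1dist y x.
Proof.
apply: eq_bigr => i _.
have sym (a b : int) : absz (a - b)%R = absz (b - a)%R by lia.
exact: sym.
Qed.

Lemma l1dist0 x : l1dist x x = 0%N.
Proof. by apply: big1 => i _; rewrite /= distnn. Qed.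

(** A discrete intermediate value theorem: the distance to the origin changes by at most one at each
    step. *)
Lemma path_levels x (p : seq Z) (i : nat) : path (@adjZ d) x p ->
  (l1dist 0 x <= i <= l1dist 0 (last x p))%N ->
  exists2 v, v \in x :: p & l1dist 0 v = i.
Proof.
elim: p x => [|y p IH] x /=.
  by move=> _ xi; exists x; rewrite ?mem_head//; apply/eqP; rewrite eqn_leq.
move=> /andP[/eqP xy yp] /andP[xi ip].
have [xiE|xi'] := eqVneq (l1dist 0 x) i; first by exists x; rewrite ?mem_head.
have [v vp vi] : exists2 v, v \in y :: p & l1dist 0 v = i.
  apply: IH => //; rewrite ip andbT.
  by have := l1dist_triangle 0 x y; rewrite xy; lia.
by exists v; rewrite // in_cons vp orbT.
Qed.

Lemma cluster_levels (R : realType) (phi : Z -> R) (h : R) y (i : nat) :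
  clusterO phi h y -> (i <= l1dist 0 y)%N ->
  exists2 v, clusterO phi h v & l1dist 0 v = i.
Proof.
move=> [p [p0 <- pall]] ip.
have [|v vp vi] := path_levels 0 p i p0; first by rewrite l1dist0.
exists v => //; move: p0 pall; case/splitPl: vp => p1 p2 v1.
rewrite cat_path -cat_cons all_cat => /andP[p10 _] /andP[all1 _].
by exists p1; split.
Qed.

Lemma cluster0 (R : realType) (phi : Z -> R) (h : R) y :
  clusterO phi h y -> clusterO phi h 0.
Proof. by move=> [p [_ _ /= /andP[h0 _]]]; exists [::]; split => //=; rewrite h0. Qed.

(** One point is taken on each sphere of radius [j * m ^ 4], [j < m]; the triangle inequality
    separates them. *)
Lemma separated_points C (m : nat) :
  (forall i, (i <= m ^ 5)%N -> exists2 v, C v & l1dist 0 v = i) ->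
  exists s : seq Z, [/\ uniq s, size s = m, [set` s] `<=` C &
    {in s &, forall x y, x != y -> (m ^ 4 <= l1dist x y)%N}].
Proof.
move=> lev; have /choice[f fP] : forall j, exists v,
    (j < m)%N -> C v /\ l1dist 0 v = (j * m ^ 4)%N.
  move=> j; have [jm|jm] := ltnP j m; last by exists 0.
  have [|v vC vj] := lev (j * m ^ 4)%N.
    by rewrite [(m ^ 5)%N]expnS leq_mul2r (ltnW jm) orbT.
  by exists v.
have f_inj : {in iota 0 m &, injective f}.
  move=> i j; rewrite !mem_iota /= add0n => im jm fij.
  have [_ fi] := fP i im; have [_ fj] := fP j jm.
  have : (i * m ^ 4 = j * m ^ 4)%N by rewrite -fi -fj fij.
  by move=> /eqP; rewrite eqn_pmul2r ?expn_gt0; [move=> /eqP | lia].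
exists [seq f j | j <- iota 0 m]; split.
- by rewrite map_inj_in_uniq ?iota_uniq.
- by rewrite size_map size_iota.
- by move=> v /= /mapP[j]; rewrite mem_iota => /= /fP[fC _] ->.
- move=> v v' /mapP[i + ->] /mapP[j + ->]; rewrite !mem_iota /= add0n => im jm fij.
  have [_ fi] := fP i im; have [_ fj] := fP j jm.
  have ij : i != j by apply: contraNneq fij => ->.
  have gap (a b M D : nat) : (a < b -> b * M <= a * M + D -> M <= D)%N.
    by move=> ab; have := leq_mul ab (leqnn M); rewrite mulSn; lia.
  have := l1dist_triangle 0 (f i) (f j); have := l1dist_triangle 0 (f j) (f i).
  rewrite fi fj (l1distC (f j)).
  by case: (ltngtP i j) ij => // ij _; [move=> _ | move=> + _]; apply: gap.
Qed.

(** One of two points at distance [2 * m ^ 5] is at distance at least [m ^ 5] from the origin, and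
    the cluster meets every sphere in between. *)
Lemma diam_le_cap (R : realType) (phi : Z -> R) (h : R) x y (m : nat) : (3 <= d)%N ->
  finite_set (clusterO phi h) -> clusterO phi h x -> clusterO phi h y ->
  (2 * m ^ 5 <= l1dist x y)%N -> d%:R * potential_gap * m%:R <= capZ R (clusterO phi h).
Proof.
move=> d3 finC xC yC xy; have d0 : (0 < d)%N by apply: leq_trans d3.
have [z zC zm] : exists2 z, clusterO phi h z & (m ^ 5 <= l1dist 0 z)%N.
  have := l1dist_triangle x 0 y; rewrite (l1distC x 0) => tri.
  have [xm|xm] := leqP (m ^ 5) (l1dist 0 x); first by exists x.
  by exists y => //; lia.
have [i im|s [us sm sC sep]] := separated_points (clusterO phi h) m.
  by apply: cluster_levels zC _; apply: leq_trans zm.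
apply: le_trans (separated_le_cap d3 s m us sm sep) _.
exact: cap_le.
Qed.

(** [divz] by a positive integer rounds down, so negative coordinates need no separate treatment. *)
Definition corner (L : nat) x : Z := \row_i ((x ord0 i %/ L%:Z)%Z * L%:Z).

Lemma divz_eq_mul (L : nat) (a q : int) : (0 < L)%N ->
  q * L%:Z <= a < q * L%:Z + L%:Z -> (a %/ L%:Z)%Z = q.
Proof.
move=> L0 /andP[l u]; have := divz_eq a L%:Z.
have L0' : (L%:Z != 0) by lia.
have := modz_ge0 a L0'; have := ltz_pmod a (d := L%:Z); nia.
Qed.

Lemma cornerP (L : nat) x z : (0 < L)%N ->
  (inLZ L z /\ boxL L z x) <-> z = corner L x.
Proof.
move=> L0; split => [[zL xz]|->].
  apply/matrixP => o i; rewrite (ord1 o) mxE.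
  have /dvdzP[q zq] := zL i; have := xz i; rewrite zq => xq.
  rewrite (divz_eq_mul L _ q)//; exact: zq.
split=> i; rewrite mxE; first exact: dvdz_mull.
have div (a : int) : (a %/ L%:Z)%Z * L%:Z <= a < (a %/ L%:Z)%Z * L%:Z + L%:Z.
  have := divz_eq a L%:Z; have L0' : (L%:Z != 0) by lia.
  have := modz_ge0 a L0'; have := ltz_pmod a (d := L%:Z); lia.
exact: div.
Qed.

Lemma coarseP C (L : nat) z : (0 < L)%N ->
  coarse C L z <-> exists2 x, C x & z = corner L x.
Proof.
move=> L0; split=> [[zL [x [xC xz]]]|[x xC ->]].
  by exists x => //; apply/cornerP.
by have [? ?] := (cornerP L x _ L0).2 erefl; split => //; exists x.
Qed.

Lemma inLZ_corner (L : nat) x : (0 < L)%N -> inLZ L (corner L x).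
Proof. by move=> L0; have [] := (cornerP L x _ L0).2 erefl. Qed.

Lemma corner_id (L : nat) z : (0 < L)%N -> inLZ L z -> corner L z = z.
Proof. by move=> L0 zL; apply/esym/cornerP => //; split => // i; rewrite lexx ltrDl. Qed.

Lemma corner_mul (L k : nat) x : (0 < L)%N -> (0 < k)%N ->
  corner (k * L) (corner L x) = corner (k * L) x.
Proof.
move=> L0 k0; apply/matrixP => o i; rewrite (ord1 o) !mxE.
have dd (a : int) : ((a %/ L%:Z)%Z * L%:Z %/ (k * L)%N%:Z)%Z = (a %/ (k * L)%N%:Z)%Z.
  by rewrite mulnC PoszM !divzMA_ge0// mulzK// -lt0n.
exact: (congr1 (fun q => q * _) (dd _)).
Qed.

Lemma corner_adj (L : nat) x y : (0 < L)%N -> adjZ x y ->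
  corner L x = corner L y \/ l1dist (corner L x) (corner L y) = L.
Proof.
move=> L0 /adjZP[i [s yE]].
have y_eq j : j != i -> y ord0 j = x ord0 j.
  by move=> ji; rewrite yE !mxE (negbTE ji) addr0.
have y_i : y ord0 i = x ord0 i + (if s then 1 else -1) by rewrite yE !mxE eqxx.
have near (a b : int) : b = a + (if s then 1 else -1) ->
    (a %/ L%:Z)%Z = (b %/ L%:Z)%Z \/
    absz ((a %/ L%:Z)%Z * L%:Z - (b %/ L%:Z)%Z * L%:Z)%R = L.
  move=> bE; have := divz_eq a L%:Z; have := divz_eq b L%:Z.
  have L0' : (L%:Z != 0) by lia.
  have := modz_ge0 a L0'; have := ltz_pmod a (d := L%:Z).
  have := modz_ge0 b L0'; have := ltz_pmod b (d := L%:Z).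
  move: (a %/ _)%Z (b %/ _)%Z (a %% _)%Z (b %% _)%Z => q q' r r' ? ? ? ? bE' aE'.
  have [qq'|[qq'|qq']] : q = q' \/ (q' = q + 1 \/ q' = q - 1).
  - by case: {y_i yE} s bE; nia.
  - by left.
  - by right; rewrite qq' mulrDl; lia.
  - by right; rewrite qq' mulrBl; lia.
case: (near _ _ y_i) => [iE|iE].
  left; apply/matrixP => o j; rewrite (ord1 o) !mxE.
  by have [->|/y_eq ->//] := eqVneq j i; rewrite iE.
right; rewrite l1distE (bigD1 i)//= !mxE big1 ?addn0// => j ji.
by rewrite !mxE y_eq// subrr.
Qed.

End Clusters.

(** * Dyadic subdivision and finite coverings by boxes *)

Section Boxes.
Context {d : nat}.
Local Notation Z := 'rV[int]_d.
Implicit Types (C : set Z) (x y z : Z).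

(** The index is the exponent of the children: [z] is the corner of a box of side [2 ^ j.+1]. *)
Definition children (j : nat) z : seq Z :=
  [seq \row_i (z ord0 i + (if e i then (2 ^ j)%N%:Z else 0)) | e : {ffun 'I_d -> bool}].

Lemma size_children j z : size (children j z) = (2 ^ d)%N.
Proof. by rewrite size_map -cardE card_ffun card_bool card_ord. Qed.

Lemma mem_children j x : corner (2 ^ j) x \in children j (corner (2 ^ j.+1) x).
Proof.
apply/mapP; exists [ffun i => ((2 ^ j)%N%:Z <= (x ord0 i %% (2 ^ j.+1)%N%:Z)%Z)%R].
  by rewrite mem_enum.
apply/matrixP => o i; rewrite (ord1 o) !mxE ffunE.
have half (a : int) (L : nat) : (0 < L)%N -> (a %/ L%:Z)%Z * L%:Z =
    (a %/ (2 * L)%N%:Z)%Z * (2 * L)%N%:Z + (if L%:Z <= (a %% (2 * L)%N%:Z)%Z then L%:Z else 0).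
  move=> L0; have := divz_eq a (2 * L)%N%:Z; have L0' : ((2 * L)%N%:Z != 0) by lia.
  have := modz_ge0 a L0'; have := ltz_pmod a (d := (2 * L)%N%:Z).
  move: (a %/ (2 * L)%N%:Z)%Z (a %% (2 * L)%N%:Z)%Z => q r ru r0 aE.
  case: ifP => Lr.
    by rewrite (divz_eq_mul L a (2 * q + 1))//; lia.
  by rewrite (divz_eq_mul L a (2 * q))//; lia.
by rewrite expnS half// expn_gt0.
Qed.

(** The factor [c i - 2] runs from -2 to 1, so the boxes tile the cube [-2L, 2L)^d, which contains
    all points at distance less than [2 L] from the origin. *)
Definition central_boxes (L : nat) : seq Z :=
  [seq \row_i (((c i : nat)%:Z - 2) * L%:Z) | c : {ffun 'I_d -> 'I_4}].

Lemma size_central_boxes L : size (central_boxes L) = (4 ^ d)%N.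
Proof. by rewrite size_map -cardE card_ffun !card_ord. Qed.

Lemma absz_le_l1dist x i : (absz (x ord0 i) <= l1dist 0 x)%N.
Proof.
rewrite l1distE (bigD1 i)//= mxE.
have ab (a : int) b : (absz a <= absz (0 - a)%R + b)%N by lia.
exact: ab.
Qed.

Lemma mem_central_boxes (L : nat) x : (l1dist 0 x < 2 * L)%N ->
  corner L x \in central_boxes L.
Proof.
move=> xL; apply/mapP.
exists [ffun i => inord (absz ((x ord0 i %/ L%:Z)%Z + 2)%R)]; first by rewrite mem_enum.
apply/matrixP => o i; rewrite (ord1 o) !mxE ffunE.
have quo (a : int) : (absz a < 2 * L)%N ->
    [/\ (absz ((a %/ L%:Z)%Z + 2)%R < 4)%N &
    (absz ((a %/ L%:Z)%Z + 2)%R)%:Z = (a %/ L%:Z)%Z + 2].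
  move=> aL; have L0 : (L%:Z != 0) by lia.
  have := divz_eq a L%:Z; have := modz_ge0 a L0; have := ltz_pmod a (d := L%:Z).
  move: (a %/ L%:Z)%Z (a %% L%:Z)%Z => q r ru r0 aE.
  have : - 2 <= q < 2 by nia.
  by lia.
have [q4 qE] := quo _ (leq_ltn_trans (absz_le_l1dist x i) xL).
by rewrite inordK// qE addrK.
Qed.

(** A superset of the box, with one spare value per coordinate, so that the index type is an ordinal
    ['I_n.+1] as [inord] requires. *)
Definition box_points (L : nat) z : seq Z :=
  [seq \row_i (z ord0 i + (c i : nat)%:Z) | c : {ffun 'I_d -> 'I_L.+1}].

Lemma size_box_points L z : size (box_points L z) = (L.+1 ^ d)%N.
Proof. by rewrite size_map -cardE card_ffun !card_ord. Qed.

Lemma mem_box_points L z x : boxL L z x -> x \in box_points L z.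
Proof.
move=> xz; apply/mapP.
exists [ffun i => inord (absz (x ord0 i - z ord0 i)%R)]; first by rewrite mem_enum.
apply/matrixP => o i; rewrite (ord1 o) !mxE ffunE.
have dist (a b : int) : b <= a < b + L%:Z ->
    (absz (a - b)%R < L.+1)%N /\ a = b + (absz (a - b)%R)%:Z by lia.
have [i4 iE] := dist _ _ (xz i).
by rewrite inordK.
Qed.

Lemma cap_le_boxes (R : realType) (K : set Z) (L : nat) (zs : seq Z) :
  (0 < d)%N -> (0 < L)%N -> (forall x, K x -> corner L x \in zs) ->
  capZ R K <= (2 * d * (size zs * L.+1 ^ d))%:R.
Proof.
move=> d0 L0 Kzs; pose s := flatten [seq box_points L z | z <- zs].
have <- : size s = (size zs * L.+1 ^ d)%N.
  rewrite size_flatten /shape -map_comp sumnE big_map.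
  rewrite (eq_bigr (fun=> (L.+1 ^ d)%N)) => [|z _]; last by rewrite /= size_box_points.
  by rewrite big_const_seq count_predT iter_addn addn0 mulnC.
apply: cap_le_size => // x /Kzs xzs; apply/flatten_mapP; exists (corner L x) => //.
by apply: mem_box_points; have [] := (cornerP L x _ L0).2 erefl.
Qed.

Lemma finite_box L z : finite_set (boxL L z).
Proof. by apply: sub_finite_set (finite_seq (box_points L z)) => x /mem_box_points. Qed.

Lemma finite_coarse C (L : nat) : (0 < L)%N -> finite_set C -> finite_set (coarse C L).
Proof.
move=> L0 finC; apply: (@sub_finite_set _ _ (corner L @` C)); last exact: finite_image.
by move=> z /coarseP-/(_ L0)[x xC ->]; exists x.
Qed.

Lemma seq_argmax (T : eqType) (f : T -> nat) (s : seq T) a : a \in s ->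
  exists2 b, b \in s & forall c, c \in s -> (f c <= f b)%N.
Proof.
elim: s a => [//|b s IH] a _; case: s IH => [|b' s] IH.
  by exists b; rewrite ?mem_head// => c /[!inE] /eqP ->.
have [c cs cmax] := IH b' (mem_head _ _).
have [bc|cb] := leqP (f b) (f c).
  by exists c; [rewrite in_cons cs orbT | move=> e /[1!in_cons] /orP[/eqP ->//|/cmax]].
exists b; rewrite ?mem_head// => e /[1!in_cons] /orP[/eqP ->//|/cmax ec].
exact: leq_trans ec (ltnW cb).
Qed.

Lemma gdiam_attained (R : realType) C x : finite_set C -> C x ->
  exists a b, [/\ C a, C b, gdiam R C = (l1dist a b)%:R%:E &
    forall y, C y -> (l1dist x y <= l1dist a b)%N].
Proof.
move=> /finite_seqP[s CE] xC; have xs : x \in s by move: xC; rewrite CE.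
have [[a b] abs abmax] := seq_argmax _ (fun p => l1dist p.1 p.2)
  [seq (a, b) | a <- s, b <- s] (x, x) (allpairs_f _ xs xs).
move: abs => /allpairsP[[a' b'] [/= as_ bs [? ?]]]; subst a' b'.
exists a, b; split; rewrite ?CE//.
  apply/eqP; rewrite eq_le /gdiam; apply/andP; split.
    apply: ge_ereal_sup => _ [y [z [yC zC ->]]].
    have ys : y \in s := yC; have zs : z \in s := zC.
    by rewrite lee_fin ler_nat (abmax (y, z))// allpairs_f.
  by apply: ereal_sup_ubound; exists a, b.
by move=> y ys; apply: (abmax (x, y)); rewrite allpairs_f.
Qed.

End Boxes.

(** * Encoding of a multiscale exploration *)

(* In a code, [Some true] puts the box into the interface, [Some false] replaces
   it by its children, and [None] discards it. *)
Section Encoding.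
Context {T : eqType}.
Variable subboxes : nat -> T -> seq T.
Implicit Types (f : nat -> T -> option bool) (cand : seq T) (code : seq (option bool)).

Definition refine (k : nat) (s : seq T) := undup (flatten [seq subboxes k z | z <- s]).

Fixpoint run f (k : nat) cand : seq (nat * T) :=
  [seq ((2 ^ k)%N, z) | z <- cand & f k z == Some true] ++
  if k is k'.+1 then run f k' (refine k' [seq z <- cand | f k z == Some false]) else [::].

(** The labels in the order of exploration, scale by scale from the top; this is the code of
    [run f k cand]. *)
Fixpoint trace f (k : nat) cand : seq (option bool) :=
  [seq f k z | z <- cand] ++
  if k is k'.+1 then trace f k' (refine k' [seq z <- cand | f k z == Some false]) else [::].

(** Recovers the boxes from the labels alone, without [f], so that interfaces can be counted by
    counting codes. *)
Fixpoint decode_boxes (k : nat) cand code : seq (nat * T) :=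
  let labelled := zip cand code in
  [seq ((2 ^ k)%N, p.1) | p <- labelled & p.2 == Some true] ++
  if k is k'.+1 then
    decode_boxes k' (refine k' [seq p.1 | p <- labelled & p.2 == Some false])
      (drop (size cand) code)
  else [::].

(** The arbitrary suffix makes it possible to pad all codes to a common length. *)
Lemma decode_boxes_trace f k cand code :
  decode_boxes k cand (trace f k cand ++ code) = run f k cand.
Proof.
have zipE cnd rest (g : T -> option bool) b :
    [seq p.1 | p <- zip cnd (map g cnd ++ rest) & p.2 == b] =
    [seq z <- cnd | g z == b].
  elim: cnd => [|z cnd IH] /=; first by case: rest.
  by case: eqP => _ /=; rewrite IH.
have out cnd rest (g : T -> option bool) (b : option bool) (L : nat) :
    [seq (L, p.1) | p <- zip cnd (map g cnd ++ rest) & p.2 == b] =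
    [seq (L, z) | z <- cnd & g z == b].
  by rewrite -(zipE cnd rest g b) -map_comp.
elim: k cand code => [|k IH] cand code /=; rewrite -!catA out //.
by rewrite zipE drop_size_cat ?size_map// IH.
Qed.

Lemma size_run f k cand : (size (run f k cand) <= size (trace f k cand))%N.
Proof.
elim: k cand => [|k IH] cand /=; rewrite !size_cat !size_map.
  by rewrite !addn0 size_filter count_size.
by rewrite leq_add// size_filter count_size.
Qed.

Lemma run_sound f k cand a : a \in run f k cand ->
  exists j, [/\ (j <= k)%N, a.1 = (2 ^ j)%N & f j a.2 = Some true].
Proof.
have out j cnd : a \in [seq ((2 ^ j)%N, z) | z <- cnd & f j z == Some true] ->
    a.1 = (2 ^ j)%N /\ f j a.2 = Some true.
  by move=> /mapP[z]; rewrite mem_filter => /andP[/eqP fz _] ->.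
elim: k cand => [|k IH] cand /=; rewrite mem_cat => /orP[/out[a1 a2]|].
- by exists 0%N.
- by rewrite in_nil.
- by exists k.+1.
- by move=> /IH[j [jk ? ?]]; exists j; split => //; apply: leqW.
Qed.

(** [anc] is the chain of ancestors along which the exploration descends to the box [anc j]. *)
Lemma run_complete f k cand (anc : nat -> T) (j : nat) : (j <= k)%N ->
  anc k \in cand -> (forall i, (j <= i < k)%N -> anc i \in subboxes i (anc i.+1)) ->
  (forall i, (j < i <= k)%N -> f i (anc i) = Some false) -> f j (anc j) = Some true ->
  ((2 ^ j)%N, anc j) \in run f k cand.
Proof.
move=> + + + + fj; elim: k cand => [|k IH] cand jk anck child fi /=; rewrite mem_cat.
  move: jk anck fj; rewrite leqn0 => /eqP -> anc0 f0; apply/orP; left.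
  by apply/mapP; exists (anc 0%N); rewrite ?mem_filter ?f0 ?eqxx.
move: jk; rewrite leq_eqVlt => /predU1P[jE|jk].
  apply/orP; left; rewrite jE in fj *.
  by apply/mapP; exists (anc k.+1); rewrite ?mem_filter ?fj ?eqxx.
apply/orP; right; apply: IH => // [|i /andP[ji ik]|i /andP[ji ik]].
- rewrite mem_undup; apply/flatten_mapP; exists (anc k.+1).
    by rewrite mem_filter anck fi ?eqxx// jk leqnn.
  by apply: child; rewrite leqnn andbT.
- by apply: child; rewrite ji leqW.
- by apply: fi; rewrite ji leqW.
Qed.

(** Every label beyond those of the initial boxes belongs to a child of an expanded box, and
    [beta j] bounds the number of boxes expanded at exponent [j]. Nothing is expanded at exponent 0,
    so the sum starts at 1. *)
Lemma size_trace (R : numDomainType) f k cand (beta : nat -> R) (c : nat) :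
  (forall j z, (size (subboxes j z) <= c)%N) -> uniq cand ->
  (forall j s, uniq s -> {in s, forall z, f j z = Some false} -> (size s)%:R <= beta j) ->
  (size (trace f k cand))%:R <= (size cand)%:R + \sum_(1 <= j < k.+1) c%:R * beta j.
Proof.
move=> subc + fbeta; elim: k cand => [|k IH] cand ucand /=; rewrite size_cat size_map natrD.
  by rewrite big_geq// addr0.
rewrite lerD2l big_nat_recr//= addrC; set exp := [seq z <- cand | _].
have exp_le : (size (refine k exp))%:R <= c%:R * beta k.+1.
  apply: (@le_trans _ _ (c * size exp)%:R).
    rewrite ler_nat (leq_trans (size_undup _))// size_flatten /shape -map_comp.
    rewrite sumnE big_map; apply: (@leq_trans (\sum_(z <- exp) c)%N).
      by apply: leq_sum => z _; apply: subc.
    by rewrite big_const_seq count_predT iter_addn addn0.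
  rewrite natrM ler_wpM2l// fbeta ?filter_uniq// => z.
  by rewrite mem_filter => /andP[/eqP].
by apply: le_trans (IH _ (undup_uniq _)) _; rewrite lerD2r.
Qed.

End Encoding.

(** * Bad and very bad boxes *)

Lemma adjZ_step (d : nat) (x : 'rV[int]_d) i s : adjZ x (x + unitstep i s).
Proof.
apply/eqP; rewrite l1distE (bigD1 i)//= !mxE eqxx big1 => [|j ji].
  have one (a : int) : absz (a - (a + (if s then 1 else -1)))%R = 1%N by case: s; lia.
  by rewrite addn0; apply: one.
by rewrite !mxE (negbTE ji) addr0 subrr.
Qed.

Lemma finite_vclosure (d : nat) (K : set 'rV[int]_d) : finite_set K -> finite_set (vclosure K).
Proof.
move=> finK; apply: (@sub_finite_set _ _ (K `|`
  \bigcup_(p in [set: 'I_d * bool]) (fun y => y + unitstep p.1 p.2) @` K)).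
  move=> x [xK|[y [yK /eqP xy]]]; [by left | right].
  have /adjZP[i [s ->]] : adjZ y x by rewrite /adjZ l1distC xy.
  by exists (i, s) => //; exists y.
rewrite finite_setU; split=> //; apply: bigcup_finite => // p _.
exact: finite_image.
Qed.

Section BadBoxes.
Context {R : realType} {d : nat}.
Hypothesis d_gt0 : (0 < d)%N.
Local Notation Z := 'rV[int]_d.
Variables (C : set Z) (eb ev : nat -> Z -> Prop) (k : nat).
Implicit Types (x y z : Z) (i j : nat).
Local Notation S j := (coarse C (2 ^ j)).
Local Notation cor j x := (corner (2 ^ j) x).

Hypothesis finC : finite_set C.
Hypothesis bdryE : forall j z, (j <= k)%N -> boxbd (S j) (2 ^ j) z -> eb j z \/ ev j z.
Hypothesis nbrE : forall j z z', inLZ (2 ^ j) z -> inLZ (2 ^ j) z' ->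
  l1dist z z' = (2 ^ j)%N -> S j z -> S j z' -> eb j z -> eb j z' \/ ev j z'.

(** Asking for bad ancestors up to the top scale ensures that a top-down exploration reaches these
    boxes, and that distinct very bad boxes are disjoint once the two kinds of events exclude each
    other. *)
Definition bad j z := S j z /\ forall i, (j <= i <= k)%N -> eb i (cor i z).
Definition very_bad j z := [/\ S j z, ev j z & forall i, (j < i <= k)%N -> eb i (cor i z)].

Let pow2_gt0 j : (0 < 2 ^ j)%N. Proof. by rewrite expn_gt0. Qed.

Lemma corner_corner i j x : (i <= j)%N -> cor j (cor i x) = cor j x.
Proof. by move=> ij; rewrite -(subnK ij) expnD corner_mul// pow2_gt0. Qed.

Lemma coarse_corner j x : C x -> S j (cor j x).
Proof. by move=> xC; apply/coarseP => //; exists x. Qed.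

Lemma coarse_up i j x : (i <= j)%N -> S i (cor i x) -> S j (cor j x).
Proof.
move=> ij /coarseP-/(_ (pow2_gt0 i))[c cC xc].
by rewrite -(corner_corner i)// xc corner_corner//; apply: coarse_corner.
Qed.

Lemma finite_covered : finite_set [set x | exists2 j, (j <= k)%N & S j (cor j x)].
Proof.
apply: (@sub_finite_set _ _ (\bigcup_(z in S k) boxL (2 ^ k) z)).
  move=> x [j jk xj]; exists (cor k x); first exact: coarse_up xj.
  by have [] := (cornerP (2 ^ k) x _ (pow2_gt0 k)).2 erefl.
by apply: bigcup_finite; [apply: finite_coarse | move=> z _; apply: finite_box].
Qed.

Lemma finite_bad j : finite_set (bad j).
Proof. by apply: sub_finite_set (finite_coarse C (2 ^ j) _ finC) => // z []. Qed.

Lemma bad_up i j z : (i <= j <= k)%N -> bad i z -> bad j (cor j z).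
Proof.
move=> /andP[ij jk] [/coarseP-/(_ (pow2_gt0 i))[x xC zE] badz]; split.
  by rewrite zE corner_corner//; apply: coarse_corner.
move=> l /andP[jl lk]; rewrite corner_corner//; apply: badz.
by rewrite lk (leq_trans ij).
Qed.

Lemma very_bad_up i j z : (i < j <= k)%N -> very_bad i z -> bad j (cor j z).
Proof.
move=> /andP[ij jk] [/coarseP-/(_ (pow2_gt0 i))[x xC zE] _ badz]; split.
  by rewrite zE corner_corner ?(ltnW ij)//; apply: coarse_corner.
move=> l /andP[jl lk]; rewrite corner_corner//; apply: badz.
by rewrite lk (leq_trans ij).
Qed.

Lemma bad_eb j z : (j <= k)%N -> bad j z -> eb j z.
Proof.
move=> jk [zS badz]; have [zL _] := zS.
by rewrite -(corner_id (2 ^ j) z)//; apply: badz; rewrite leqnn.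
Qed.

Variable j0 : nat.
Hypothesis j0k : (j0 <= k)%N.

Definition very_bad_region : set Z :=
  [set x | exists2 j, (j0 <= j <= k)%N & very_bad j (cor j x)].
Definition bad_region : set Z := [set x | bad j0 (cor j0 x)].
Let V := very_bad_region `|` bad_region.
(** The invariant of a walk that has not yet entered [V]. It holds vacuously far from [C], hence
    outside a finite set. *)
Let outer y := forall j, (j0 <= j <= k)%N -> S j (cor j y) -> eb j (cor j y).

(** If some box of [y'] violates the invariant, then the coarsest such box is very bad and all its
    ancestors are bad, so [y'] lies in [V]. *)
Lemma outer_step y y' : outer y -> adjZ y y' -> V y' \/ outer y'.
Proof.
move=> yout yy'; apply: contrapT => /not_orP[yV]; apply => j.
(* Induction from the top scale downwards: the boxes of [y'] at coarser scales are already known to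
   be bad. *)
have [n] := ubnP (k - j); elim: n j => [//|n IH] j kjn /andP[j0j jk] yS.
have above i : (j < i <= k)%N -> eb i (cor i y').
  move=> /andP[ji ik]; apply: IH; [by lia | by rewrite ik andbT (leq_trans j0j)// ltnW |].
  exact: coarse_up (ltnW ji) yS.
(* Either both points share a box, or the box of [y] meets [C] and is a bad neighbour, or it misses
   [C] and the box of [y'] is a boundary box. *)
have [//|ev'] : eb j (cor j y') \/ ev j (cor j y').
  have [yj|yj] := corner_adj (2 ^ j) y y' (pow2_gt0 j) yy'.
    by left; rewrite -yj; apply: yout; rewrite ?j0j// yj.
  have [ySj|ySj] := pselect (S j (cor j y)).
    apply: (nbrE j (cor j y)) => //; try exact: inLZ_corner.
    by apply: yout; rewrite ?j0j.
  apply: bdryE => //; split => //; exists (cor j y); split => //.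
    exact: inLZ_corner.
  by rewrite l1distC.
case: yV; left; exists j; first by rewrite j0j.
split => // i /andP[ji ik]; rewrite corner_corner ?(ltnW ji)//.
by apply: above; rewrite ji.
Qed.

Lemma finite_very_bad_region : finite_set very_bad_region.
Proof.
apply: sub_finite_set finite_covered => x [j /andP[_ jk] [xS _ _]].
by exists j.
Qed.

Lemma finite_bad_region : finite_set bad_region.
Proof. by apply: sub_finite_set finite_covered => x [xS _]; exists j0. Qed.

(** A walk started at an outer point remains outer until it enters [V], and an outer point of [C] is
    already in [V]. *)
Lemma hit_outer n y : outer y -> hit C n y <= hit V n y :> R.
Proof.
(* All boxes of a point of [C] meet [C], so the invariant makes all of them bad. *)
have CV x : outer x -> C x -> V x.
  move=> xout xC; right; split; first exact: coarse_corner.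
  move=> i /andP[j0i ik]; rewrite corner_corner//.
  by apply: xout; rewrite ?j0i//; apply: coarse_corner.
elim: n y => [|n IH] y yout.
  case: (boolP (y \in C)) => [/set_mem yC|yC].
    by rewrite [leRHS]hit_in ?hit_le1// mem_set//; apply: CV.
  by rewrite /= (negbTE yC) ler0n.
case: (boolP (y \in V)) => yV; first by rewrite [leRHS]hit_in// hit_le1.
have yC : y \notin C by apply: contra yV => /set_mem yC; apply/mem_set/CV.
rewrite /= (negbTE yC) (negbTE yV); apply: avg_le => i s.
have [yV'|yout'] := outer_step _ _ yout (adjZ_step d y i s); last exact: IH.
by rewrite [leRHS]hit_in ?hit_le1// mem_set.
Qed.

(* A nearest neighbour path reaching [C] from far away enters at every scale through
   a bad or very bad box, and can only leave a bad box of the coarse-grained cluster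
   through another such box; so it meets a very bad region or ends in a bad box of
   the smallest scale. *)
Lemma cap_cluster_le : capZ R C <= capZ R very_bad_region + capZ R bad_region.
Proof.
apply: le_trans (capU d_gt0 _ _ finite_very_bad_region finite_bad_region).
have finV : finite_set V.
  by rewrite finite_setU; split; [exact: finite_very_bad_region | exact: finite_bad_region].
have -> : capZ R (very_bad_region `|` bad_region) = \sum_(K <- [:: V]) capZ R K.
  by rewrite big_seq1.
apply: (cap_le_sum d_gt0 _ _ (~` outer)) => //.
- by move=> K /[!inE] /eqP ->.
- apply: sub_finite_set finite_covered => y /existsNP[j] /not_implyP[/andP[_ jk]].
  by move=> /not_implyP[yS _]; exists j.
- move=> n y /contrapT yout; rewrite big_seq1.
  by apply: le_trans (hit_leS d_gt0 _ _ _); apply: hit_outer.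
Qed.

Lemma cap_bad_region (b : nat) : (#|` fset_set (bad j0)| <= b)%N ->
  capZ R bad_region <= (2 * d * (b * (2 ^ j0).+1 ^ d))%:R.
Proof.
move=> badb; apply: (@le_trans _ _ (2 * d * (size (fset_set (bad j0)) * (2 ^ j0).+1 ^ d))%:R).
  apply: cap_le_boxes => // x xb; rewrite in_fset_set; first exact/mem_set.
  exact: finite_bad.
by rewrite ler_nat !leq_mul2l leq_mul2r badb !orbT.
Qed.

End BadBoxes.

(** * Interfaces *)

Lemma geometric_tail_le (R : realFieldType) (x : R) (lo n : nat) : 0 <= x < 1 ->
  \sum_(1 <= j < n.+1) (if (lo < j)%N then x ^+ j else 0) <= x ^+ lo / (1 - x).
Proof.
move=> /andP[x0 x1]; have x1' : 0 < 1 - x by rewrite subr_gt0.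
(* The subtracted power makes the bound telescope; [maxn] covers the range where the sum is still
   empty. *)
suff : \sum_(1 <= j < n.+1) (if (lo < j)%N then x ^+ j else 0) <=
    (x ^+ lo - x ^+ maxn lo n) / (1 - x).
  by move=> /le_trans; apply; rewrite ler_pM2r ?invr_gt0// gerBl exprn_ge0.
elim: n => [|n IH]; first by rewrite big_geq// maxn0 subrr mul0r.
rewrite big_nat_recr//=; case: ifPn => lon; last first.
  by move: IH; rewrite addr0 !(maxn_idPl _)//; lia.
have lon' : (lo <= n)%N by lia.
move: IH; rewrite !(maxn_idPr _)//; last by lia.
rewrite !ler_pdivlMr// mulrDl => IH.
  have := mulr_ge0 (exprn_ge0 n x0) (sqr_ge0 (1 - x)).
  move: IH; rewrite (exprS x n).
  by move: (x ^+ n) (x ^+ lo) (\sum_(_ <= _ < _) _) => p q s; nra.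
Qed.

Lemma min_scale_mem (d : nat) (I : seq (nat * 'rV[int]_d)) : I != [::] ->
  exists2 a, a \in I & min_scale I = a.1.
Proof.
case: I => [//|a I] _; rewrite /min_scale /=.
have [b bI ->] : exists2 b, b \in a :: I & foldr minn a.1 (map fst I) = b.1.
  elim: I => [|b I [c cI IH]] /=; first by exists a; rewrite ?mem_head.
  rewrite IH -/(minn b.1 c.1); have [bc|cb] := leqP b.1 c.1.
    by exists b; rewrite ?inE ?eqxx ?orbT.
  exists c => //.
  by move: cI; rewrite !inE => /orP[->//|->]; rewrite !orbT.
rewrite -/(minn a.1 b.1); have [ab|ba] := leqP a.1 b.1.
  by exists a; rewrite ?mem_head.
by exists b.
Qed.

Section Interface.
Context {d : nat}.
Local Notation Z := 'rV[int]_d.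
Variables (C : set Z) (eb : nat -> Z -> Prop) (k : nat).
Implicit Types (x y z : Z) (i j : nat).
Local Notation S j := (coarse C (2 ^ j)).
Local Notation cor j x := (corner (2 ^ j) x).
Local Notation bad := (bad C eb k).

Hypothesis finC : finite_set C.
Hypothesis C_small : forall x, C x -> (l1dist 0 x < 2 ^ k.+1)%N.
(** [out] selects the boxes of the interface and [lo] is the last scale explored. This serves both
    for the bad boxes of the stopping scale and for the very bad boxes of all scales. *)
Variables (out : nat -> Z -> Prop) (lo : nat).
Hypothesis outP : forall j z, out j z -> [/\ (lo <= j <= k)%N, S j z &
  forall i, (j < i <= k)%N -> bad i (cor i z) /\ ~ out i (cor i z)].

Let pow2_gt0 j : (0 < 2 ^ j)%N. Proof. by rewrite expn_gt0. Qed.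

(** The test on [out] comes first, so that a selected bad box is kept instead of being expanded. *)
Definition label j z : option bool :=
  if `[< out j z >] then Some true
  else if `[< bad j z >] && (lo < j <= k)%N then Some false else None.

Definition start : seq Z := undup (central_boxes (2 ^ k)).

Definition interface : seq (nat * Z) := undup (run children label k start).

Lemma label_out j z : label j z = Some true <-> out j z.
Proof.
rewrite /label; split; last by move=> o; rewrite asboolT.
by case: asboolP => // _; case: ifP.
Qed.

Lemma mem_interface (a : nat * Z) :
  a \in interface <-> exists2 j, a.1 = (2 ^ j)%N & out j a.2.
Proof.
rewrite mem_undup; split.
  by move=> /run_sound[j [_ aj /label_out]]; exists j.
case: a => L z [j /= -> zout]; have [/andP[loj jk] zS badz] := outP _ _ zout.
have [x xC zE] := (coarseP C (2 ^ j) z (pow2_gt0 j)).1 zS; rewrite zE.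
have cc i : (j <= i)%N -> cor i z = cor i x by move=> ji; rewrite zE corner_corner.
apply: (run_complete children _ _ _ (fun i => cor i x)) => //.
- by rewrite mem_undup; apply: mem_central_boxes; rewrite -expnS; apply: C_small.
- by move=> i _; apply: mem_children.
- move=> i /andP[ji ik]; have [|ibad inout] := badz i; first by rewrite ji.
  rewrite -cc ?(ltnW ji)// /label asboolF// asboolT//= ik (leq_ltn_trans loj)//.
- by rewrite -zE; apply/label_out.
Qed.

Lemma interfaceP j z : out j z -> is_interface interface.
Proof.
move=> zout; have latt (a : nat * Z) i : a.1 = (2 ^ i)%N -> out i a.2 ->
    (0 < a.1)%N /\ inLZ a.1 a.2.
  by move=> -> /outP[_ [aL _] _]; split.
split.
- by have : ((2 ^ j)%N, z) \in interface by [apply/mem_interface; exists j]; case: interface.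
- exact: undup_uniq.
- by move=> a /mem_interface[i ai /(latt _ _ ai)].
- move=> a b /mem_interface[i ai aout] /mem_interface[l bl bout] ab.
  apply/eqP/negPn/negP => /set0P[x [xa xb]].
  have aE : a.2 = cor i x.
    by apply/cornerP => //; have [_] := latt _ _ ai aout; rewrite ai in xa *.
  have bE : b.2 = cor l x.
    by apply/cornerP => //; have [_] := latt _ _ bl bout; rewrite bl in xb *.
  (* Dyadic boxes with a common point are nested, and [outP] forbids a selected box to have a
     selected ancestor. *)
  have disj i' l' : (i' < l')%N -> out i' (cor i' x) -> out l' (cor l' x) -> False.
    move=> il oi ol; have [_ _ no] := outP _ _ oi; have [/andP[_ lk] _ _] := outP _ _ ol.
    by have [|_] := no l'; [rewrite il | rewrite corner_corner ?(ltnW il)].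
  rewrite aE in aout; rewrite bE in bout.
  case: (ltngtP i l) => [il|li|il]; [exact: disj il aout bout | exact: disj li bout aout |].
  by move: ab; rewrite [a]surjective_pairing [b]surjective_pairing aE bE ai bl il eqxx.
Qed.

(** Only bad boxes above scale [lo] are expanded, so their counts sum to a geometric tail; [4 ^ d]
    counts the initial boxes. *)
Lemma size_interface_trace (R : realFieldType) (T x : R) : 0 <= T -> 0 <= x < 1 ->
  (forall j, (lo < j <= k)%N -> #|` fset_set (bad j)|%:R <= T * x ^+ j) ->
  (size (trace children label k start))%:R <=
    (4 ^ d)%:R + (2 ^ d)%:R * (T * (x ^+ lo / (1 - x))).
Proof.
move=> T0 x01 badT; pose beta j : R := T * (if (lo < j)%N then x ^+ j else 0).
have [x0 _] := andP x01.
apply: le_trans (size_trace children R label k start beta (2 ^ d) _ _ _) _.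
- by move=> j z; rewrite size_children.
- exact: undup_uniq.
- move=> j s us sbad; have [->|[z zs]] : s = [::] \/ exists z, z \in s.
    by case: s {us sbad} => [|z s]; [left | right; exists z; rewrite mem_head].
    by rewrite /beta mulr_ge0//; case: ifP => // _; rewrite exprn_ge0.
  have loj : (lo < j <= k)%N.
    by move: (sbad z zs); rewrite /label; case: ifP => // _; case: ifP => // /andP[].
  apply: (@le_trans _ _ #|` fset_set (bad j)|%:R).
    rewrite ler_nat; apply: uniq_leq_size => // y /sbad; rewrite /label.
    case: ifP => // _; case: ifP => // /andP[/asboolP ybad _] _.
    by rewrite in_fset_set ?mem_set//; apply: finite_bad.
  by rewrite /beta; have /andP[-> _] := loj; apply: badT.
- rewrite lerD//.
    by rewrite ler_nat (leq_trans (size_undup _))// size_central_boxes.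
  rewrite -mulr_sumr ler_wpM2l// -mulr_sumr ler_wpM2l//.
  exact: geometric_tail_le.
Qed.

End Interface.

Definition codes (n : nat) : seq (seq (option bool)) :=
  [seq val c | c : n.-tuple (option bool)].

Lemma size_codes n : size (codes n) = (3 ^ n)%N.
Proof. by rewrite size_map -cardE card_tuple card_option card_bool. Qed.

Lemma mem_codes n (c : seq (option bool)) : size c = n -> c \in codes n.
Proof. by move=> <-; apply/mapP; exists (in_tuple c); rewrite ?mem_enum. Qed.

Lemma powR_pow2 (R : realType) (rho : R) (j : nat) : (2 ^ j)%:R `^ rho = (2 `^ rho) ^+ j.
Proof.
by rewrite natrX -powR_mulrn// -powRrM mulrC powRrM powR_mulrn ?powR_ge0.
Qed.

Lemma exists_exp_le (R : realType) (x c e : R) : 0 <= x < 1 -> 0 <= c -> 0 < e ->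
  exists n, c * x ^+ n <= e.
Proof.
move=> /andP[x0 x1] c0 e0; have cx : (fun n => c * x ^+ n) @ \oo --> (0 : R).
  by rewrite -(mulr0 c); apply: cvgMl_tmp; apply: cvg_expr; rewrite ger0_norm.
have /cvgr0Pnorm_le/(_ e e0)[n _ cn] := cx.
by exists n; apply: le_trans (ler_norm _) (cn n (leqnn n)).
Qed.

(** With [b = 6 e], the bound follows from [(e N)^6 <= exp (6 e N)]. It absorbs the polynomial
    number of top scales. *)
Lemma poly_le_expR (R : realType) (a b : R) : 0 < b -> 0 <= a ->
  exists N0, forall N, N0 <= N -> 0 <= N -> 2 * (a * N) ^+ 5 <= expR (b * N).
Proof.
move=> b0 a0; have [e e0 ->] : exists2 e, 0 < e & b = 6%:R * e.
  by exists (b / 6); [rewrite divr_gt0 | field].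
exists (2 * a ^+ 5 / e ^+ 6) => N NN0 N0.
have le_exp : (e * N) ^+ 6 <= expR (6%:R * e * N).
  rewrite -mulrA expRM_natl; apply: lerXn2r; rewrite ?nnegrE ?expR_ge0 ?mulr_ge0 ?(ltW e0)//.
  by apply: le_trans _ (expR_ge1Dx _); rewrite lerDr.
apply: le_trans le_exp; rewrite !exprMn mulrA [N ^+ 6]exprS [leRHS]mulrA.
by rewrite ler_wpM2r ?exprn_ge0// [leRHS]mulrC -ler_pdivrMr ?exprn_gt0.
Qed.

(** * The interface of a single realisation *)

Section ClusterInterface.
Context {R : realType} {d : nat}.
Hypothesis d_ge3 : (3 <= d)%N.
Local Notation Z := 'rV[int]_d.
Let d_gt0 : (0 < d)%N. Proof. exact: leq_trans d_ge3. Qed.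

(** The interface is given through a labelling, because the length of the trace is what bounds the
    length of its code. *)
Lemma cluster_interface (rho : R) (h : R) (Omega : Type) (phi : Omega -> Z -> R)
    (Eb Evb : nat -> Z -> Omega -> Prop) (w : Omega) (k j0 N D : nat) (t : R) :
  let C := clusterO (phi w) h in let x := (2 `^ rho)^-1 in
  (forall L, (0 < L)%N -> admissible phi h L (Eb L) (Evb L)) ->
  0 < rho -> 0 < t -> t * (16 * d ^ 2 * (2 ^ j0).+1 ^ d)%:R <= 1 -> (4 <= N)%N ->
  finite_set C -> N%:R - 1 <= capZ R (vclosure C) ->
  (forall y, C y -> (l1dist 0 y < 2 ^ k.+1)%N) -> gdiam R C = D%:R%:E -> (2 ^ k <= D)%N ->
  (j0 <= k)%N ->
  exists f, let I := undup (run children f k (start k)) in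
    (size (trace children f k (start k)))%:R <=
      (4 ^ d)%:R + (2 ^ d)%:R * (t * N%:R * (x ^+ j0 / (1 - x))) /\
    [/\ is_interface I, (forall a, a \in I -> (2 ^ j0 <= a.1 <= 2 ^ k)%N),
        occursI Eb Evb I w, (forall a, a \in I -> Eb a.1 a.2 w -> a.1 = min_scale I)
      & N%:R / (4 * d)%:R <= capZ R (vb_union Evb I w) \/
        t * N%:R <= (nbad Eb I w)%:R * (min_scale I)%:R `^ rho].
Proof.
move=> C x adm rho0 t0 tle N4 finC capC C_small diamC Dk j0k.
have pow2_gt0 j : (0 < 2 ^ j)%N by rewrite expn_gt0.
pose eb j z := Eb (2 ^ j)%N z w; pose ev j z := Evb (2 ^ j)%N z w.
have y1 : 1 < 2 `^ rho :> R by rewrite /powR pnatr_eq0 /= expR_gt1 mulr_gt0// ln_gt0// ltr1n.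
have y0 : 0 < 2 `^ rho :> R by apply: lt_trans y1.
have x01 : 0 <= x < 1 by rewrite invr_ge0 (ltW y0) invf_lt1.
have [x0 x1] := andP x01.
have T0 : 0 < t * N%:R by rewrite mulr_gt0// ltr0n; lia.
have excl j z : inLZ (2 ^ j) z -> eb j z -> ev j z -> False.
  by move=> zL be ve; have [/(_ z w zL) no _ _] := adm _ (pow2_gt0 j); apply: no.
have bdryE j z : (j <= k)%N -> boxbd (coarse C (2 ^ j)) (2 ^ j) z -> eb j z \/ ev j z.
  move=> jk zbd; have [_ bd _] := adm _ (pow2_gt0 j); apply: bd zbd; rewrite diamC ?ltry//.
  by rewrite lee_fin ler_nat (leq_trans _ Dk)// leq_exp2l.
have nbrE j z z' : inLZ (2 ^ j) z -> inLZ (2 ^ j) z' ->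
    l1dist z z' = (2 ^ j)%N -> coarse C (2 ^ j) z -> coarse C (2 ^ j) z' ->
    eb j z -> eb j z' \/ ev j z'.
  by move=> zL zL' zz' zS zS' be; have [_ _ nb] := adm _ (pow2_gt0 j); apply: nb zz' zS zS' be.
pose B j := #|` fset_set (bad C eb k j)|.
have expx j : (2 `^ rho) ^+ j * x ^+ j = 1.
  by rewrite -exprMn mulfV ?expr1n// gt_eqF.
(* The stopping condition, which is (c2) at scale [2 ^ j], since [(2 ^ j) ^ rho = (2 ^ rho) ^ j]. *)
pose P j := (j0 <= j <= k)%N && (t * N%:R <= (B j)%:R * (2 `^ rho) ^+ j).
have small j : (j0 <= j <= k)%N -> ~~ P j -> (B j)%:R <= t * N%:R * x ^+ j.
  rewrite /P => -> /=; rewrite -ltNge => /ltW Bj.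
  have -> : (B j)%:R = (B j)%:R * (2 `^ rho) ^+ j * x ^+ j by rewrite -mulrA expx mulr1.
  by apply: ler_wpM2r Bj; apply: exprn_ge0.
have decr lo : (j0 <= lo)%N ->
    (4 ^ d)%:R + (2 ^ d)%:R * (t * N%:R * (x ^+ lo / (1 - x))) <=
    (4 ^ d)%:R + (2 ^ d)%:R * (t * N%:R * (x ^+ j0 / (1 - x))).
  move=> jlo; rewrite lerD2l ler_wpM2l// ler_wpM2l ?(ltW T0)//.
  rewrite ler_wpM2r ?invr_ge0 ?subr_ge0 ?(ltW x1)//.
  by rewrite ler_wiXn2l// (ltW x1).
have [[j Pj]|noP] := pselect (exists j, P j).
  have Pk i : P i -> (i <= k)%N by move=> /andP[/andP[]].
  (* The largest such scale is the first one met on the way down, so the bad boxes are few at all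
     coarser scales. *)
  have [js Pjs jsmax] := ex_maxnP (ex_intro P j Pj) Pk.
  have /andP[jsk Bjs] := Pjs; have /andP[j0js jsk'] := jsk.
  pose out i z := i = js /\ bad C eb k i z.
  have outP i z : out i z -> [/\ (js <= i <= k)%N, coarse C (2 ^ i) z &
      forall l, (i < l <= k)%N ->
        bad C eb k l (corner (2 ^ l) z) /\ ~ out l (corner (2 ^ l) z)].
    move=> [-> badz]; split; rewrite ?leqnn//; first by case: badz.
    move=> l /andP[jsl lk]; split; last by move=> [lE]; rewrite lE ltnn in jsl.
    by apply: bad_up badz; rewrite ltnW.
  pose f := label C eb k out js; exists f; cbv zeta.
  rewrite -/(interface C eb k out js); set I := interface _ _ _ _ _.
  have memI := mem_interface C eb k C_small out js outP; rewrite -/I in memI.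
  (* The threshold [t N] is positive, so a bad box exists and the interface is nonempty. *)
  have [z zB] : exists z, bad C eb k js z.
    have [B0|] := posnP (B js).
      by move: Bjs; rewrite B0 mul0r leNgt T0.
    rewrite cardfs_gt0 => /fset0Pn[z]; rewrite in_fset_set; last exact: finite_bad.
    by move=> /set_mem zB; exists z.
  have intI : is_interface I by apply: (interfaceP C eb k C_small out js outP js z).
  have [I0 uI _ _] := intI.
  have scale a : a \in I -> a.1 = (2 ^ js)%N /\ bad C eb k js a.2.
    by move=> /memI[i -> [-> ?]].
  have min_js : min_scale I = (2 ^ js)%N.
    by have [a /scale[aE _] ->] := min_scale_mem _ _ I0.
  have Eb_I a : a \in I -> Eb a.1 a.2 w.
    by move=> /scale[-> /bad_eb]; apply.
  split; first last.
    split.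
    - by [].
    - by move=> a /scale[-> _]; rewrite !leq_exp2l.
    - by move=> a /Eb_I; left.
    - by move=> a /scale[-> _] _; rewrite min_js.
    - right; rewrite min_js powR_pow2; apply: (le_trans Bjs).
      rewrite ler_wpM2r ?exprn_ge0 ?(ltW y0)// ler_nat.
      have -> : nbad Eb I w = size I.
        by apply/eqP; rewrite -all_count; apply/allP => a /Eb_I Ea; apply/asboolP.
      rewrite /B -(size_map (pair (2 ^ js)%N)); apply: uniq_leq_size.
        by rewrite map_inj_uniq ?fset_uniq// => a b [].
      move=> _ /mapP[a + ->]; rewrite in_fset_set; last exact: finite_bad.
      by move=> /set_mem aB; apply/memI; exists js.
  apply: le_trans (decr js j0js).
  apply: (size_interface_trace C eb k finC out js R) => //; first exact: ltW.
  move=> i /andP[jsi ik]; apply: small; first by rewrite ik andbT (leq_trans j0js)// ltnW.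
  by apply/negP => /jsmax; rewrite leqNgt jsi.
have {}small j : (j0 <= j <= k)%N -> (B j)%:R <= t * N%:R * x ^+ j.
  by move=> jk; apply: small => //; apply/negP => Pj; apply: noP; exists j.
pose VB := very_bad_region C eb ev k j0.
have finVB : finite_set VB by apply: finite_very_bad_region.
(* The closure costs a factor [2 d]. At most [t N] bad boxes remain at scale [2 ^ j0], each of
   capacity at most [2 d (2 ^ j0 + 1) ^ d]; with this factor they amount to at most [N / 4] by the
   bound on [t]. Finally [N - 1 - N / 4 >= N / 2] for [N >= 4]. *)
have cap_VB : N%:R / (4 * d)%:R <= capZ R VB.
  have capC' : N%:R - 1 <= (2 * d)%:R * (capZ R VB + (2 * d * (B j0 * (2 ^ j0).+1 ^ d))%:R).
    apply: (le_trans capC).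
    apply: (le_trans (cap_vclosure d_gt0 _ finC (finite_vclosure _ _ finC))).
    rewrite ler_wpM2l//.
    apply: (le_trans (cap_cluster_le d_gt0 C eb ev k finC bdryE nbrE j0 j0k)).
    rewrite lerD2l; apply: cap_bad_region => //.
  have Bj0 : (B j0)%:R <= t * N%:R.
    apply: le_trans (small j0 _) _; first by rewrite leqnn.
    by rewrite ler_piMr ?(ltW T0)// exprn_ile1// ltW.
  move: capC' tle Bj0; rewrite !natrM !natrX.
  have : 4 <= N%:R :> R by rewrite ler_nat.
  have : 3 <= d%:R :> R by rewrite ler_nat.
  have : 1 <= (2 ^ j0).+1%:R ^+ d :> R by rewrite exprn_ege1// ler1n.
  move: (capZ R VB) (d%:R : R) ((2 ^ j0).+1%:R ^+ d : R) ((B j0)%:R : R) (N%:R : R).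
  move=> c e M b n M1 e3 n4 cn tM bn.
  have bM : b * (16 * e ^+ 2 * M) <= n.
    apply: (@le_trans _ _ (t * n * (16 * e ^+ 2 * M))).
      by rewrite ler_wpM2r// !mulr_ge0 ?sqr_ge0//; lra.
    rewrite mulrAC -[leRHS]mul1r ler_wpM2r//; lra.
  rewrite ler_pdivrMr ?mulr_gt0//; last by lra.
  by move: cn bM; rewrite !expr2; nra.
pose out i z := (j0 <= i <= k)%N /\ very_bad C eb ev k i z.
have outP i z : out i z -> [/\ (j0 <= i <= k)%N, coarse C (2 ^ i) z &
    forall l, (i < l <= k)%N -> bad C eb k l (corner (2 ^ l) z) /\ ~ out l (corner (2 ^ l) z)].
  move=> [ik zvb]; split => //; first by case: zvb.
  (* The ancestors of a very bad box are bad, hence not very bad by exclusion, so none of them is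
     selected. *)
  move=> l lk; have lbad := very_bad_up _ _ _ _ _ _ _ lk zvb; split=> // -[_ [lS lev _]].
  have [lL _] := lS; apply: excl lL _ lev; apply: bad_eb lbad.
  by case/andP: lk.
pose f := label C eb k out j0; exists f; cbv zeta.
rewrite -/(interface C eb k out j0); set I := interface _ _ _ _ _.
have memI := mem_interface C eb k C_small out j0 outP; rewrite -/I in memI.
have [v vVB] : exists v, VB v.
  apply: contrapT => VB0; suff VBE : VB = set0.
    move: cap_VB; rewrite VBE /capZ fsbig_set0 leNgt divr_gt0// ltr0n; first lia.
    by rewrite muln_gt0.
  by apply/seteqP; split => // v vVB; apply: VB0; exists v.
have intI : is_interface I.
  by case: vVB => j jk jv; apply: (interfaceP C eb k C_small out j0 outP j (corner (2 ^ j) v)).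
have ev_I a : a \in I -> Evb a.1 a.2 w.
  by move=> /memI[i -> [_ []]].
have not_eb_I a : a \in I -> ~ Eb a.1 a.2 w.
  by move=> /memI[i -> [_ [[aL _] aev _]]] aeb; apply: excl aL aeb aev.
split.
  apply: (size_interface_trace C eb k finC out j0 R) => //; first exact: ltW.
  by move=> i /andP[ji ik]; apply: small; rewrite ik andbT ltnW.
split.
- by [].
- by move=> a /memI[i -> [/andP[ji ik] _]]; rewrite !leq_exp2l// ji.
- by move=> a /ev_I; right.
- by move=> a /not_eb_I.
left; apply: (le_trans cap_VB); apply: cap_le => //.
  apply: (@sub_finite_set _ _ (\bigcup_(a in [set` I]) boxL a.1 a.2)).
    by move=> y [a aI [_ ya]]; exists a.
  by apply: bigcup_finite; [exact: finite_seq | move=> a _; apply: finite_box].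
move=> y [j jk yv]; exists ((2 ^ j)%N, corner (2 ^ j) y); first by apply/memI; exists j.
have [yS yev _] := yv; split => //=.
by have [] := (cornerP (2 ^ j) y _ (pow2_gt0 j)).2 erefl.
Qed.

End ClusterInterface.

(** * The theorem *)

Theorem theorem3p2 (R : realType) (d : nat) (hd : (3 <= d)%N)
    (rho delta : R) (hrho : 0 < rho) (hdelta : 0 < delta) :
  exists t L0 N0 : R,
  [/\ 0 < t < 1, 0 < L0, 0 < N0 &
   forall (h : R) (Omega : Type) (phi : Omega -> 'rV[int]_d -> R)
          (Eb Evb : nat -> 'rV[int]_d -> Omega -> Prop),
     (forall L : nat, (0 < L)%N -> admissible phi h L (Eb L) (Evb L)) ->
     forall N : nat, N0 <= N%:R ->
     exists IN : seq (seq (nat * 'rV[int]_d)),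
       [/\ (size IN)%:R <= expR (delta * t * N%:R),
           (forall I, I \in IN ->
              [/\ is_interface I, L0 <= (min_scale I)%:R
                & (size I)%:R <= delta * t * N%:R])
         & (forall w : Omega, A_event phi h N w ->
              exists2 I, I \in IN &
                [/\ occursI Eb Evb I w,
                    ((max_scale I)%:R%:E <= gdiam R (clusterO (phi w) h))%E,
                    (forall a, a \in I -> Eb a.1 a.2 w -> a.1 = min_scale I)
                  & (N%:R / (4 * d)%:R <= capZ R (vb_union Evb I w)
                     \/ t * N%:R <= (nbad Eb I w)%:R * ((min_scale I)%:R `^ rho))])]].
Proof.
have d_gt0 : (0 < d)%N by apply: leq_trans hd.
have y1 : 1 < 2 `^ rho :> R by rewrite /powR pnatr_eq0 /= expR_gt1 mulr_gt0// ln_gt0// ltr1n.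
have y0 : 0 < 2 `^ rho :> R by apply: lt_trans y1.
pose x : R := (2 `^ rho)^-1.
have x01 : 0 <= x < 1 by rewrite invr_ge0 (ltW y0) invf_lt1.
(* This [j0] makes the geometric sum in the code length at most [delta t N / 8]. *)
have [j0 j0E] : exists j0, (2 ^ d)%:R / (1 - x) * x ^+ j0 <= delta / 8.
  apply: exists_exp_le => //; last by rewrite divr_gt0.
  by rewrite divr_ge0// subr_ge0 ltW//; case/andP: x01.
(* [t = 1 / M] is the largest value that [cluster_interface] admits. *)
pose M := (16 * d ^ 2 * (2 ^ j0).+1 ^ d)%N.
have M1 : (1 < M)%N.
  rewrite /M -mulnA; have : (0 < d ^ 2 * (2 ^ j0).+1 ^ d)%N.
    by rewrite muln_gt0 !expn_gt0 d_gt0.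
  lia.
pose t : R := M%:R^-1; have M0 : 0 < M%:R :> R by rewrite ltr0n (ltn_trans _ M1).
have t0 : 0 < t by rewrite invr_gt0.
have dt0 : 0 < delta * t by rewrite mulr_gt0.
pose c : R := d%:R * potential_gap.
have c0 : 0 < c by rewrite mulr_gt0 ?ltr0n// potential_gap_gt0.
have dt2 : 0 < delta * t / 2 by rewrite divr_gt0.
have c1 : 0 <= c^-1 + 1 by rewrite addr_ge0// invr_ge0 ltW.
have [N1 N1E] := poly_le_expR R (c^-1 + 1) (delta * t / 2) dt2 c1.
(* For [N >= N2] the diameter is at least [2 ^ j0]: otherwise [4 ^ d] boxes of this scale cover the
   cluster and its closure has capacity below [N - 1]. *)
pose N2 : R := (2 * d * (2 * d * (4 ^ d * (2 ^ j0).+1 ^ d)))%:R + 2.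
(* For [N >= N3] the [4 ^ d] initial labels are at most [delta t N / 8]. *)
pose N3 : R := 8 * (4 ^ d)%:R / (delta * t).
exists t, (2 ^ j0)%:R, (Num.max (Num.max N1 N2) (Num.max N3 4)); split.
- by rewrite t0 invf_lt1// ltr1n.
- by rewrite ltr0n expn_gt0.
- by rewrite !lt_max (_ : 0 < 4 :> R) ?orbT// ltr0n.
move=> h Omega phi Eb Evb adm N; rewrite !ge_max => /andP[/andP[NN1 NN2] /andP[NN3 N4]].
have {}N4 : (4 <= N)%N by rewrite -(ler_nat R).
(* The capacity is below [N < c m], which forces the diameter below [2 * m ^ 5]; this bounds the
   exponent of the top scale. *)
pose m := (Num.truncn (N%:R / c)).+1.
have Nm : N%:R < c * m%:R by rewrite mulrC -ltr_pdivrMr// truncnS_gt.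
have mN : m%:R <= (c^-1 + 1) * N%:R.
  have -> : m%:R = (Num.truncn (N%:R / c))%:R + 1 :> R by rewrite natr1.
  rewrite mulrDl mul1r [c^-1 * _]mulrC; apply: lerD.
    by rewrite -truncn_ge_nat// divr_ge0// ltW.
  by rewrite ler1n (leq_trans _ N4).
clearbody m; pose K := (2 * m ^ 5)%N.
(* The common code length. There are [3 ^ n0 <= exp (2 n0) <= exp (delta t N / 2)] codes, and the
   other half of the exponent pays for the choice of the top scale. *)
pose n0 := Num.truncn (delta * t * N%:R / 4).
have dtN0 : 0 <= delta * t * N%:R / 4 by rewrite divr_ge0// mulr_ge0// ltW.
have n0le : n0%:R <= delta * t * N%:R / 4 by rewrite -truncn_ge_nat.
pose valid (I : seq (nat * 'rV[int]_d)) :=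
  [/\ is_interface I, (2 ^ j0)%:R <= (min_scale I)%:R :> R & (size I)%:R <= delta * t * N%:R].
pose IN : seq (seq (nat * 'rV[int]_d)) :=
  [seq undup (decode_boxes children k (start k) e) | k <- iota 0 K, e <- codes n0].
(* Filtering makes (b) automatic; validity remains to be checked only for the interfaces used in
   (c). *)
exists [seq I <- IN | `[< valid I >]]; split.
- apply: (@le_trans _ _ (size IN)%:R); first by rewrite ler_nat size_filter count_size.
  rewrite size_allpairs size_iota size_codes natrM.
  have -> : delta * t * N%:R = delta * t / 2 * N%:R + delta * t / 2 * N%:R by field.
  rewrite expRD ler_pM//.
    apply: le_trans (N1E _ NN1 (ler0n _ _)).
    rewrite natrM natrX ler_wpM2l// lerXn2r ?nnegrE ?mulr_ge0 ?addr_ge0 ?invr_ge0 ?(ltW c0)//.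
  rewrite natrX.
  apply: (@le_trans _ _ (expR 2 ^+ n0)).
    rewrite lerXn2r ?nnegrE ?expR_ge0//; apply: le_trans (expR_ge1Dx _).
    by rewrite -natr1 addrC.
  rewrite -expRM_natl ler_expR; lra.
- by move=> I; rewrite mem_filter => /andP[/asboolP].
move=> w [finC [capC capN]]; set C := clusterO (phi w) h in finC capC capN *.
have finV := finite_vclosure _ _ finC.
have C0 : C 0.
  apply: contrapT => nC0; have CE : C = set0.
    by apply/seteqP; split => // y /cluster0.
  have vE : vclosure C = set0.
    by rewrite CE; apply/seteqP; split => // y [//|[z []]].
  move: capC; rewrite vE /capZ fsbig_set0.
  have : 4 <= N%:R :> R by rewrite ler_nat.
  by lra.
have [a [b [aC bC diamC Cab]]] := gdiam_attained R C 0 finC C0.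
set D := l1dist a b in diamC Cab.
have DK : (D < K)%N.
  rewrite ltnNge; apply/negP => KD.
  have := diam_le_cap R (phi w) h a b m hd finC aC bC KD.
  apply/negP; rewrite -ltNge; apply: (@lt_trans _ _ N%:R).
    apply: le_lt_trans capN; apply: cap_le => //; by left.
  exact: Nm.
have j0D : (2 ^ j0 <= D)%N.
  rewrite leqNgt; apply/negP => Dj0.
  have : capZ R C <= (2 * d * (4 ^ d * (2 ^ j0).+1 ^ d))%:R.
    rewrite -(size_central_boxes (2 ^ j0)); apply: cap_le_boxes => //.
      by rewrite expn_gt0.
    move=> y /Cab yD; apply: mem_central_boxes.
    by rewrite mul2n -addnn ltn_addr// (leq_ltn_trans yD).
  have := le_trans capC (cap_vclosure d_gt0 _ finC finV).
  move: NN2; rewrite /N2 natrM => NN2 capC' capC2.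
  have := ler_wpM2l (ler0n R (2 * d)) capC2; lra.
pose k := trunc_log 2 D.
have D0 : (0 < D)%N by apply: leq_trans j0D; rewrite expn_gt0.
have kD : (2 ^ k <= D)%N by apply: trunc_logP.
have Dk : (D < 2 ^ k.+1)%N by apply: trunc_log_ltn.
have j0k : (j0 <= k)%N by apply: trunc_log_max.
have tM : t * M%:R <= 1 by rewrite mulVf// gt_eqF.
have C_small y : C y -> (l1dist 0 y < 2 ^ k.+1)%N.
  by move=> /Cab yD; apply: leq_ltn_trans Dk.
have [f [tr [intI scI occ ebI concl]]] :=
  cluster_interface hd rho h Omega phi Eb Evb w k j0 N D t adm hrho t0 tM N4
    finC capC C_small diamC kD j0k.
set I := undup (run children f k (start k)) in intI scI occ ebI concl *.
have tr_n0 : (size (trace children f k (start k)) <= n0)%N.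
  rewrite truncn_ge_nat//; apply: (le_trans tr).
  have -> : (2 ^ d)%:R * (t * N%:R * ((2 `^ rho)^-1 ^+ j0 / (1 - (2 `^ rho)^-1))) =
      t * N%:R * ((2 ^ d)%:R / (1 - x) * x ^+ j0) by rewrite /x; ring.
  have := ler_wpM2l (mulr_ge0 (ltW t0) (ler0n R N)) j0E.
  move: NN3; rewrite /N3 ler_pdivrMr//; lra.
have [I0 _ _ _] := intI; have [a0 a0I min_a0] := min_scale_mem _ _ I0.
exists I.
  rewrite mem_filter; apply/andP; split.
    apply/asboolP; split => //.
      by rewrite min_a0 ler_nat; case/andP: (scI _ a0I).
    apply: (@le_trans _ _ n0%:R).
      by rewrite ler_nat (leq_trans (size_undup _))// (leq_trans (size_run _ _ _ _))//.
    by apply: le_trans n0le _; rewrite ler_pdivrMr//; nra.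
  set tr0 := trace children f k (start k) in tr_n0.
  (* Padding with [None] brings the code to length [n0]; the decoder ignores what follows the
     trace. *)
  apply/allpairsP; exists (k, tr0 ++ nseq (n0 - size tr0) None).
  split => /=.
  - by rewrite mem_iota /= add0n (ltn_trans (ltn_expl k (ltnSn 1)))// (leq_ltn_trans kD).
  - by apply: mem_codes; rewrite size_cat size_nseq subnKC.
  - by rewrite decode_boxes_trace.
split => //; rewrite diamC lee_fin ler_nat; apply: leq_trans kD.
by apply/bigmax_leqP_seq => a' /scI/andP[].
Qed.
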